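(* Let $\ell\ge1$ be an integer and let $(V,\varepsilon)$ be an inner product space. Then $$\mathcal{J}_{2\ell}^{(2)}(V,\varepsilon)=\operatorname{Span}_{\sigma\in\operatorname{Perm}(4\ell)}\left\{P^{(2)}_{2\ell,1,\sigma,\varepsilon},\,P^{(2)}_{2\ell,2,\sigma,\varepsilon}\right\}.$$
   Context: An inner product space $(V,\varepsilon)$ is a finite-dimensional real vector space $V$ with a non-degenerate symmetric bilinear form $\varepsilon$ of arbitrary signature; $\mathcal{O}(V,\varepsilon)$ is its orthogonal group, acting on tensor powers of $V^*$ by pullback. $\mathfrak{A}(V)\subset\otimes^4(V^* )$ is the space of algebraic curvature tensors: those $A$ such that for all $x,y,z,w\in V$, $A(x,y,z,w)=-A(y,x,z,w)=A(z,w,x,y)$ and $A(x,y,z,w)+A(y,z,x,w)+A(z,x,y,w)=0$. $S^2(V^* )$ is the space of symmetric $2$-cotensors, and $x\circ y=\frac12(x\otimes y+y\otimes x)$. $\mathcal{J}^{(2)}_{2\ell}(V,\varepsilon)$ is the real vector space of all $\mathcal{O}(V,\varepsilon)$-equivariant linear maps from $\otimes^\ell(\mathfrak{A}(V))$ to $S^2(V^* )$. $\operatorname{Perm}(4\ell)$ is the group of permutations of $\{1,\dots,4\ell\}$, $\sigma_i=\sigma(i)$. Let $\{e_i\}$ be a basis of $V$ with dual basis $\{e^i\}$, let $\varepsilon^{ij}$ be the inverse matrix of $\varepsilon_{ij}=\varepsilon(e_i,e_j)$, and sum over repeated indices. For $\eta\in\otimes^{\ell}(\mathfrak{A}(V))\subset\otimes^{4\ell}(V^*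 )$ with components $\eta_{i_1\dots i_{4\ell}}$ set $$P^{(2)}_{2\ell,1,\sigma,\varepsilon}(\eta)=\varepsilon^{i_1i_2}\cdots\varepsilon^{i_{4\ell-3}i_{4\ell-2}}\,\eta_{i_{\sigma_1}i_{\sigma_2}\dots i_{\sigma_{4\ell}}}\,e^{i_{4\ell-1}}\circ e^{i_{4\ell}},$$ $$P^{(2)}_{2\ell,2,\sigma,\varepsilon}(\eta)=\varepsilon^{i_1i_2}\cdots\varepsilon^{i_{4\ell-1}i_{4\ell}}\,\eta_{i_{\sigma_1}i_{\sigma_2}\dots i_{\sigma_{4\ell}}}\,\varepsilon .$$ These are independent of the choice of basis. *)

(* Defs.v *)
From HB Require Import structures.
From mathcomp Require Import all_boot all_order all_fingroup all_algebra.
From mathcomp Require Import boolp classical_sets functions reals.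
From mathcomp Require Import ring.

Set Implicit Arguments.
Unset Strict Implicit.
Unset Printing Implicit Defensive.

Import GRing.Theory.

Local Open Scope classical_set_scope.
Local Open Scope ring_scope.

Section LinearSpan.
Variables (R : nzRingType) (U : lmodType R).
Implicit Types S : set U.

Definition lspan S : set U :=
  [set u | exists (n : nat) (c : 'I_n -> R) (s : 'I_n -> U),
    (forall i, S (s i)) /\ u = \sum_(i < n) c i *: s i].

Lemma lspan_submod_closed S : submod_closed ([pred u | `[< lspan S u >]]).
Proof.
split.
  rewrite inE; exists 0%N, (fun _ => 0), (fun _ => 0).
  by split; [case | rewrite big_ord0].
move=> a u v; rewrite !inE => -[m [c [s [Ss ->]]]] [n [d [t [St ->]]]].
pose w (f : 'I_m -> U) (g : 'I_n -> U) i :=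
  match fintype.split i with inl j => f j | inr j => g j end.
exists (m + n)%N,
  (fun i => match fintype.split i with inl j => a * c j | inr j => d j end).
exists (w s t); split; first by move=> i; rewrite /w; case: fintype.split.
rewrite big_split_ord /= scaler_sumr /w; congr (_ + _); apply: eq_bigr => i _.
  by rewrite (unsplitK (inl i)) scalerA.
by rewrite (unsplitK (inr i)).
Qed.

End LinearSpan.

Section Cotensors.
Variables (R : realType) (V : vectType R).

(* All functions of k vectors; the elements of the k-th tensor power of V^* are
   those which are [multilinear]. *)
Definition cotensor (k : nat) := ('I_k -> V) -> R^o.

HB.instance Definition _ k := GRing.Lmodule.on (cotensor k).

Definition multilinear k (t : cotensor k) :=
  forall (i : 'I_k) (x : 'I_k -> V), scalar (fun v : V => t (@dfwith _ _ x i v)).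

Definition pullback (g : 'End(V)) k (t : cotensor k) : cotensor k :=
  fun x => t (fun i => g (x i)).

Definition alg_curvature : set (cotensor 4) :=
  [set A | multilinear A /\ forall x y z w : V,
    [/\ A (tnth [tuple x; y; z; w]) = - A (tnth [tuple y; x; z; w]),
        A (tnth [tuple x; y; z; w]) = A (tnth [tuple z; w; x; y])
      & A (tnth [tuple x; y; z; w]) + A (tnth [tuple y; z; x; w])
        + A (tnth [tuple z; x; y; w]) = 0]].

Section TensorPower.
Variable l : nat.

Lemma slot_subproof (a : 'I_l) (j : 'I_4) : (4 * a + j < 4 * l)%N.
Proof.
apply: (@leq_trans (4 * a + 4)); first by rewrite ltn_add2l.
by rewrite -mulnSr leq_mul2l /=.
Qed.

Definition slot (a : 'I_l) (j : 'I_4) : 'I_(4 * l) :=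
  Ordinal (slot_subproof a j).

Definition tensor_prod (A : 'I_l -> cotensor 4) : cotensor (4 * l) :=
  fun x => \prod_(a < l) A a (fun j => x (slot a j)).

Definition curvature_power : set (cotensor (4 * l)) :=
  lspan [set tensor_prod A | A in [set A | forall a, alg_curvature (A a)]].

End TensorPower.

Definition sym2_cotensor : set (cotensor 2) :=
  [set s | multilinear s /\
    forall u v : V, s (tnth [tuple u; v]) = s (tnth [tuple v; u])].

Lemma multilinear_comb k a (s t : cotensor k) :
  multilinear s -> multilinear t -> multilinear (a *: s + t).
Proof.
move=> Ms Mt i x b u v.
have E y : (a *: s + t) y = a * s y + t y by [].
by rewrite !E Ms Mt !mulrDr -/(_ *: _) mulrCA addrACA.
Qed.

Lemma dfwith_comp (g : 'End(V)) k (x : 'I_k -> V) i (v : V) :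
  (fun j => g (@dfwith _ _ x i v j)) =
  @dfwith _ (fun=> (V : Type)) (fun j => g (x j)) i (g v).
Proof.
apply: funext => j; have [<-|ij] := eqVneq i j; first by rewrite !dfwith_in.
by rewrite !dfwith_out.
Qed.

Lemma multilinear_pullback (g : 'End(V)) k (t : cotensor k) :
  multilinear t -> multilinear (pullback g t).
Proof.
by move=> Mt i x a u v; rewrite /pullback !dfwith_comp linearP Mt.
Qed.

Lemma tnth_comp (g : 'End(V)) k (x : k.-tuple V) :
  (fun i => g (tnth x i)) = tnth (map_tuple g x).
Proof. by apply: funext => i; rewrite tnth_map. Qed.

Lemma alg_curvature_pullback (g : 'End(V)) A :
  alg_curvature A -> alg_curvature (pullback g A).
Proof.
case=> MA HA; split; first exact: multilinear_pullback.
have E (x y z w : V) : pullback g A (tnth [tuple x; y; z; w]) =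
    A (tnth [tuple g x; g y; g z; g w]).
  by rewrite /pullback tnth_comp; congr (A (tnth _)); apply: val_inj.
by move=> x y z w; rewrite !E; exact: HA.
Qed.

Lemma curvature_power_pullback (g : 'End(V)) l t :
  curvature_power (l := l) t -> curvature_power (pullback g t).
Proof.
case=> n [c [s [Ss ->]]]; exists n, c, (fun i => pullback g (s i)); split.
  move=> i; have [A HA <-] := Ss i; exists (fun a => pullback g (A a)) => //.
  by move=> a; apply: alg_curvature_pullback; exact: HA.
by apply: funext => x; rewrite /pullback !fct_sumE.
Qed.

Lemma sym2_cotensor_pullback (g : 'End(V)) s :
  sym2_cotensor s -> sym2_cotensor (pullback g s).
Proof.
case=> Ms Hs; split; first exact: multilinear_pullback.
have E (u v : V) : pullback g s (tnth [tuple u; v]) = s (tnth [tuple g u; g v]).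
  by rewrite /pullback tnth_comp; congr (s (tnth _)); apply: val_inj.
by move=> u v; rewrite !E Hs.
Qed.

Definition curvature_pred l : {pred cotensor (4 * l)} :=
  fun t => `[< curvature_power t >].

Definition sym2_pred : {pred cotensor 2} := fun s => `[< sym2_cotensor s >].

Lemma curvature_predE l t : (t \in @curvature_pred l) = `[< curvature_power t >].
Proof. by []. Qed.

Lemma sym2_predE s : (s \in sym2_pred) = `[< sym2_cotensor s >].
Proof. by []. Qed.

Lemma sym2_cotensor_submod_closed : submod_closed sym2_pred.
Proof.
split.
  rewrite inE; split => // i x a u v.
  by rewrite -[RHS]/(a * 0 + 0) mulr0 addr0.
move=> a s t; rewrite !inE => -[Ms Hs] [Mt Ht]; split.
  exact: multilinear_comb.
have E y : (a *: s + t) y = a * s y + t y by [].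
by move=> u v; rewrite !E Hs Ht.
Qed.

HB.instance Definition _ l := GRing.isSubmodClosed.Build R (cotensor (4 * l))
  (@curvature_pred l) (lspan_submod_closed _).

HB.instance Definition _ := GRing.isSubmodClosed.Build R (cotensor 2)
  sym2_pred sym2_cotensor_submod_closed.

Record curvature_tensor (l : nat) := CurvatureTensor {
  curvature_val :> cotensor (4 * l);
  curvature_valP : curvature_val \in @curvature_pred l }.

HB.instance Definition _ l := [isSub for @curvature_val l].
HB.instance Definition _ l := [Choice of curvature_tensor l by <:].
HB.instance Definition _ l :=
  [SubChoice_isSubLmodule of curvature_tensor l by <:].

Record sym2 := Sym2 {
  sym2_val :> cotensor 2;
  sym2_valP : sym2_val \in sym2_pred }.

HB.instance Definition _ := [isSub for sym2_val].
HB.instance Definition _ := [Choice of sym2 by <:].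
HB.instance Definition _ := [SubChoice_isSubLmodule of sym2 by <:].

Lemma curvature_pullback_subproof (g : 'End(V)) l (eta : curvature_tensor l) :
  pullback g eta \in @curvature_pred l.
Proof.
rewrite inE; apply: curvature_power_pullback.
by have := curvature_valP eta; rewrite inE.
Qed.

Definition curvature_pullback (g : 'End(V)) l (eta : curvature_tensor l) :=
  CurvatureTensor (curvature_pullback_subproof g eta).

Lemma sym2_pullback_subproof (g : 'End(V)) (s : sym2) :
  pullback g s \in sym2_pred.
Proof.
rewrite inE; apply: sym2_cotensor_pullback.
by have := sym2_valP s; rewrite inE.
Qed.

Definition sym2_pullback (g : 'End(V)) (s : sym2) :=
  Sym2 (sym2_pullback_subproof g s).

Lemma ord2P (i : 'I_2) : i = 0 \/ i = 1.
Proof. by case: i => [[|[|//]] i2]; [left | right]; apply: val_inj. Qed.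

Lemma bilinear_multilinear (b : V -> V -> R) :
    (forall v, scalar (b^~ v)) -> (forall u, scalar (b u)) ->
  multilinear (fun x : 'I_2 -> V => b (x 0) (x 1) : R^o).
Proof.
move=> Hl Hr i x a u v.
by case: (ord2P i) => ->; rewrite !dfwith_in !dfwith_out ?Hl ?Hr.
Qed.

Lemma sym_prod_subproof (a b : {scalar V}) :
  (fun x : 'I_2 -> V => 2^-1 * (a (x 0) * b (x 1) + b (x 0) * a (x 1)) : R^o)
    \in sym2_pred.
Proof.
rewrite sym2_predE; apply/asboolP; split; last first.
  by move=> u v; rewrite !(tnth_nth 0) /= addrC ![b _ * _]mulrC.
pose f u v := 2^-1 * (a u * b v + b u * a v).
by apply: (@bilinear_multilinear f) => w k u v; rewrite /f !linearP /=; ring.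
Qed.

Definition sym_prod (a b : {scalar V}) : sym2 := Sym2 (sym_prod_subproof a b).

Lemma form_sym2_subproof (eps : {symmetric V}) :
  (fun x : 'I_2 -> V => eps (x 0) (x 1) : R^o) \in sym2_pred.
Proof.
rewrite sym2_predE; apply/asboolP; split; last first.
  by move=> u v; rewrite !(tnth_nth 0) /= hermC expr0 mul1r.
apply: bilinear_multilinear => w k u v.
  by rewrite linearPl.
by rewrite linearPr.
Qed.

Definition form_sym2 (eps : {symmetric V}) : sym2 :=
  Sym2 (form_sym2_subproof eps).

Definition orthogonal_group (eps : {symmetric V}) : set 'End(V) :=
  [set g | lker g == 0%VS /\ isometry eps eps g].

Definition equivariant_maps (eps : {symmetric V}) l :
    set (curvature_tensor l -> sym2) :=
  [set phi | linear phi /\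
    forall g, orthogonal_group eps g ->
      forall eta, phi (curvature_pullback g eta) = sym2_pullback g (phi eta)].

Section Contractions.
Variables (l : nat) (eps : {symmetric V}) (n : nat) (e : n.-tuple V).

Definition gram : 'M[R]_n := \matrix_(i, j) eps (tnth e i) (tnth e j).

Lemma pair_fst_subproof (k : 'I_(2 * l)) : (2 * k < 4 * l)%N.
Proof. by rewrite -[4%N]/(2 * 2)%N -mulnA ltn_pmul2l. Qed.

Lemma pair_snd_subproof (k : 'I_(2 * l)) : ((2 * k).+1 < 4 * l)%N.
Proof.
by apply: (@leq_trans (2 * k.+1)); rewrite ?mulnS // -[4%N]/(2 * 2)%N -mulnA
  -mulnS leq_pmul2l.
Qed.

Definition pair_fst (k : 'I_(2 * l)) : 'I_(4 * l) := Ordinal (pair_fst_subproof k).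
Definition pair_snd (k : 'I_(2 * l)) : 'I_(4 * l) := Ordinal (pair_snd_subproof k).

Lemma last_pair_subproof : (0 < l)%N -> ((2 * l).-1 < 2 * l)%N.
Proof. by case: l. Qed.

Definition last_pair (hl : (0 < l)%N) : 'I_(2 * l) :=
  Ordinal (last_pair_subproof hl).

(* [i] is a multi-index (i_1, ..., i_{4l}), numbered from 0; the k-th factor
   eps^{i_{2k+1} i_{2k+2}} is an entry of the inverse Gram matrix. *)
Definition eps_inv (i : {ffun 'I_(4 * l) -> 'I_n}) (k : 'I_(2 * l)) : R :=
  invmx gram (i (pair_fst k)) (i (pair_snd k)).

Definition component (sigma : 'S_(4 * l)) (eta : curvature_tensor l)
    (i : {ffun 'I_(4 * l) -> 'I_n}) : R :=
  curvature_val eta (fun j => tnth e (i (sigma j))).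

(* [coord e a] is the a-th covector of the basis dual to [e]. *)
Definition P1 (hl : (0 < l)%N) (sigma : 'S_(4 * l)) (eta : curvature_tensor l) :
    sym2 :=
  \sum_(i : {ffun 'I_(4 * l) -> 'I_n})
    ((\prod_(k < 2 * l | k != last_pair hl) eps_inv i k) * component sigma eta i)
      *: sym_prod (coord e (i (pair_fst (last_pair hl))))
                  (coord e (i (pair_snd (last_pair hl)))).

Definition P2 (sigma : 'S_(4 * l)) (eta : curvature_tensor l) : sym2 :=
  (\sum_(i : {ffun 'I_(4 * l) -> 'I_n})
    (\prod_(k < 2 * l) eps_inv i k) * component sigma eta i) *: form_sym2 eps.

End Contractions.

End Cotensors.

Arguments equivariant_maps {R V} eps l.

(* Main.v *)
Require Import Defs.
From HB Require Import structures.
From mathcomp Require Import all_boot all_order all_fingroup all_algebra.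
From mathcomp Require Import boolp classical_sets functions reals.
From mathcomp Require Import ring lra.

(** The contractions are equivariant because they do not depend on the basis used
    to write them ([P1_basis_independent], [P2_basis_independent]): pulling the
    tensor back along an isometry [g] is the same as replacing an orthonormal
    basis [b] by [g b].

    For the converse, fix a basis [b] in which the form is diagonal with entries
    [s a] of square 1.  An equivariant map [phi] is then given by an array:
    [phi eta] evaluated at two basis vectors is the scalar product of the array of
    components of [eta] with some array [K], which is unique once it is required to
    lie in the space [W] of arrays of components of curvature tensors
    ([riesz_representation] for the Euclidean scalar product of arrays, whatever
    the signature).  This requirement costs no equivariance: the adjoint of the
    action of a matrix is the action of its transpose, and [W] is stable under the
    pullback by every endomorphism.  So, with the argument indices lowered, [K] is
    an array in [4 l + 2] slots invariant under the orthogonal group of [s]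
    ([equivariant_kernel_value]).

    The first fundamental theorem of invariant theory ([invariant_pairings]) says
    that such an array is a combination of products of the form over perfect
    pairings of the slots.  The proof is by induction on the number of slots.  Only
    the consequences of invariance under reflections and, after differentiation of
    a rational parametrization of the rotations of the coordinate planes, under
    infinitesimal rotations are used ([invariant_on_of_group]).  Let [H] be
    invariant and orthogonal to all pairings, and let [E_ab] be the action of the
    matrix units.  Infinitesimal invariance makes the sum of the [|E_ba H|^2] equal
    to the number of slots times [|H|^2], plus scalar products of [H] with the form
    in two slots times the contraction of [H] in these slots; the latter vanish by
    induction ([square_lie_invariant]).  But the terms with [a = b] alone
    give at least twice the number of slots times [|H|^2], because a coordinate
    that occurs in an index occurs there an even number of times, hence at least
    twice ([square_lie_ge]).  So [H = 0].

    Finally a pairing either joins the two slots of the value to each other, and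
    gives a [P2], or joins them to two slots of the argument, and gives a [P1] once
    the kernel is symmetrized ([pairing_value]); the permutation is the one that
    lists the pairing. *)

Set Implicit Arguments.
Unset Strict Implicit.
Unset Printing Implicit Defensive.

Import Order.TTheory GRing.Theory Num.Theory.

Local Open Scope classical_set_scope.
Local Open Scope ring_scope.

(** * Spans and the Riesz representation *)

Section Span.
Variables (R : nzRingType) (U : lmodType R).
Implicit Types (S P : set U) (u v : U).

Lemma sub_lspan S u : S u -> lspan S u.
Proof.
move=> Su; exists 1%N, (fun=> 1), (fun=> u); split => //.
by rewrite big_ord1 scale1r.
Qed.

Lemma lspan_ind S P : P 0 ->
    (forall a u v, P u -> P v -> P (a *: u + v)) -> (forall u, S u -> P u) ->
  forall u, lspan S u -> P u.
Proof.
move=> P0 PD PS _ [m [c [t [St ->]]]].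
elim: m c t St => [|m IH] c t St; first by rewrite big_ord0.
by rewrite big_ord_recl; apply: PD; [exact: PS | apply: IH].
Qed.

Lemma lspan0 S : lspan S 0.
Proof. by have [/asboolP] := lspan_submod_closed S. Qed.

Lemma lspanP S a u v : lspan S u -> lspan S v -> lspan S (a *: u + v).
Proof.
move=> /asboolP Su /asboolP Sv; apply/asboolP.
by have [_] := lspan_submod_closed S; apply.
Qed.

End Span.

Section Riesz.
Variables (R : realFieldType) (T : finType).
Implicit Types (x y : T -> R^o) (W : set (T -> R^o)).

Definition dot x y : R := \sum_t x t * y t.

Lemma dotC x y : dot x y = dot y x.
Proof. by apply: eq_bigr => t _; rewrite mulrC. Qed.

Lemma dot_linl a x y z : dot (a *: x + y) z = a * dot x z + dot y z.
Proof.
rewrite /dot mulr_sumr -big_split; apply: eq_bigr => t _ /=.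
by rewrite mulrA -mulrDl.
Qed.

Lemma dot_linr a x y z : dot z (a *: x + y) = a * dot z x + dot z y.
Proof. by rewrite dotC dot_linl !(dotC z). Qed.

Lemma dot0r x : dot x 0 = 0.
Proof. by rewrite /dot big1 // => t _; rewrite mulr0. Qed.

Lemma dot_ge0 x : 0 <= dot x x.
Proof. by apply: sumr_ge0 => t _; rewrite -expr2 sqr_ge0. Qed.

Lemma dot_eq0 x : dot x x = 0 -> x = 0.
Proof.
move=> /eqP; rewrite psumr_eq0 => [/allP x0|t _]; last by rewrite -expr2 sqr_ge0.
apply: funext => t; have := x0 t (mem_index_enum t).
by rewrite -expr2 sqrf_eq0 => /eqP.
Qed.

Definition subspace W := W 0 /\ forall a x y, W x -> W y -> W (a *: x + y).

Definition linear_on W (f : (T -> R^o) -> R) :=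
  forall a x y, W x -> W y -> f (a *: x + y) = a * f x + f y.

(** Induction on a set of coordinates supporting [W]: if some [w] in [W] has a
    nonzero coordinate [a], the subspace of [W] where that coordinate vanishes
    has smaller support, and [W] is its sum with the line of the component of
    [w] orthogonal to it. *)
Lemma riesz_representation W (f : (T -> R^o) -> R) :
  subspace W -> linear_on W f ->
  exists2 K, W K & forall w, W w -> f w = dot K w.
Proof.
suff: forall m W (A : {set T}) f, (#|A| <= m)%N -> subspace W -> linear_on W f ->
    (forall w t, W w -> t \notin A -> w t = 0) ->
    exists2 K, W K & forall w, W w -> f w = dot K w.
  move=> H sW lf; apply: (H _ W [set: T]%SET f (leqnn _)) => // w t _.
  by rewrite finset.in_setT.
elim=> [|m IH] {}W A {}f leA [W0 WD] lf Ws.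
  exists 0 => // w Ww.
  have -> : w = 0.
    apply: funext => t; apply: Ws => //.
    by move: leA; rewrite leqn0 cards_eq0 => /eqP ->; rewrite inE.
  have := lf 1 0 0 W0 W0; rewrite scaler0 addr0 mul1r dot0r => /eqP.
  by rewrite -subr_eq0 opprD addNKr oppr_eq0 => /eqP.
have [[w [Ww [a wa]]] | noW] :=
  pselect (exists w, W w /\ exists a, w a != 0); last first.
  apply: (IH W finset.set0) => //; first by rewrite cards0.
  move=> w t Ww _; apply/eqP/negPn/negP => wt.
  by apply: noW; exists w; split => //; exists t.
pose W' := [set v | W v /\ v a = 0].
have sW' : subspace W'.
  split; first by split.
  move=> c x y [Wx xa] [Wy ya]; split; first exact: WD.
  by rewrite -[LHS]/(c * x a + y a) xa ya mulr0 addr0.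
have leA' : (#|A :\ a| <= m)%N.
  have aA : a \in A by apply/negPn/negP => aA; rewrite Ws ?eqxx in wa.
  by rewrite (cardsD1 a) aA in leA.
have Ws' v t : W' v -> t \notin A :\ a -> v t = 0.
  move=> [Wv va]; rewrite !inE negb_and negbK => /orP[/eqP -> //|].
  exact: Ws.
have [|p [Wp pa] pE] := IH W' (A :\ a)%SET (dot w) leA' sW' _ Ws'.
  by move=> c x y _ _; rewrite dot_linr.
have [|K [WK Ka] KE] := IH W' (A :\ a)%SET f leA' sW' _ Ws'.
  by move=> c x y [Wx _] [Wy _]; apply: lf.
(* the component of [w] orthogonal to [W'] *)
pose w0 : T -> R^o := (- 1) *: p + w.
have Ww0 : W w0 by exact: WD.
have w0a : w0 a = w a by rewrite -[LHS]/(- 1 * p a + w a) pa mulr0 add0r.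
have w0W' v : W' v -> dot w0 v = 0.
  by move=> W'v; rewrite dot_linl (pE v) // mulN1r addNr.
have w00 : dot w0 w0 != 0.
  by apply/eqP => /dot_eq0 E; move: wa; rewrite -w0a E => /eqP; apply.
move: w0 Ww0 w0a w0W' w00 => w0 Ww0 w0a w0W' w00.
exists ((f w0 / dot w0 w0) *: w0 + K); first exact: WD.
(* subtracting [c *: w0] cancels the coordinate [a] of [v] *)
move=> v Wv; pose c := v a / w0 a.
have W'v : W' ((- c) *: w0 + v).
  split; first exact: WD.
  rewrite -[LHS]/(- c * w0 a + v a) /c w0a mulNr divfK ?addNr //.
have -> : v = c *: w0 + ((- c) *: w0 + v).
  by rewrite scaleNr addNKr.
move: (_ + v) W'v => v' W'v.
rewrite lf //; last by have [] := W'v.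
have Kw0 : dot K w0 = 0 by rewrite dotC w0W'.
rewrite dot_linl !dot_linr (w0W' v') // -(KE _ W'v) Kw0 mulrDr mulrCA.
by rewrite divfK // !mulr0 !addr0 !add0r.
Qed.

Lemma dot_inj W x y : subspace W -> W x -> W y ->
  (forall w, W w -> dot x w = dot y w) -> x = y.
Proof.
move=> [_ WD] Wx Wy xy; apply/eqP; rewrite -subr_eq0; apply/eqP/dot_eq0.
have W1 : W ((- 1) *: y + x) by apply: WD.
by rewrite addrC -scaleN1r dot_linl xy // mulN1r addNr.
Qed.

End Riesz.

(** * Contractions of invariant arrays *)

Section Arrays.
Variables (R : realFieldType) (D I : finType) (s : I -> R).
Hypothesis s2 : forall a, s a * s a = 1.

Local Notation index := {ffun D -> I}.
Local Notation array := (index -> R^o).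
Implicit Types (i j : index) (k l : D) (a b c : I) (F G H : array) (A : {set D}).

Definition upd i k b : index := [ffun x => if x == k then b else i x].

Lemma upd_in i k b : upd i k b k = b.
Proof. by rewrite ffunE eqxx. Qed.

Lemma upd_out i k b x : x != k -> upd i k b x = i x.
Proof. by rewrite ffunE => /negPf ->. Qed.

Lemma upd_upd i k a b : upd (upd i k a) k b = upd i k b.
Proof. by apply/ffunP => x; rewrite !ffunE; case: eqP. Qed.

Lemma upd_id i k b : i k = b -> upd i k b = i.
Proof. by move=> <-; apply/ffunP => x; rewrite ffunE; case: eqP => [->|]. Qed.

Lemma updC i k l a b : k != l -> upd (upd i k a) l b = upd (upd i l b) k a.
Proof.
move=> kl; apply/ffunP => x; rewrite !ffunE.
by have [->|//] := eqVneq x l; rewrite eq_sym (negPf kl).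
Qed.

(** The matrix unit [E_ab] of [gl(I)] acting as a derivation on the slots in
    [A]. *)
Definition lie A a b F : array :=
  fun i => \sum_(k in A) (i k == a)%:R * F (upd i k b).

(** In a single slot [E_ab] and [E_ba] are adjoint: replacing the letter in the
    slot exchanges the indices that have [a] there with those that have [b]. *)
Lemma replace_adjoint k a b F G :
  \sum_(i : index) (i k == a)%:R * F (upd i k b) * G i =
  \sum_(i : index) (i k == b)%:R * F i * G (upd i k a).
Proof.
transitivity (\sum_(i : index | i k == a) F (upd i k b) * G i).
  rewrite [RHS]big_mkcond; apply: eq_bigr => i _.
  by case: eqP; rewrite ?mul1r ?mul0r.
transitivity (\sum_(i : index | i k == b) F i * G (upd i k a)); last first.
  rewrite [LHS]big_mkcond; apply: eq_bigr => i _.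
  by case: eqP; rewrite ?mul1r ?mul0r.
rewrite (reindex_onto (fun i => upd i k a) (fun i => upd i k b)) /=.
  apply: eq_big => [i|i]; rewrite upd_in eqxx upd_upd /=.
    by apply/eqP/eqP => [<-|]; [rewrite upd_in | exact: upd_id].
  by move=> /eqP ->.
by move=> i /eqP ia; rewrite upd_upd upd_id.
Qed.

Definition count A i a := #|[set k in A | i k == a]|%SET.

Lemma sum_count A i : (\sum_a count A i a)%N = #|A|.
Proof.
rewrite -sum1_card (partition_big i predT) //=.
apply: eq_bigr => a _; rewrite /count -sum1_card.
by apply: eq_bigl => k; rewrite !inE.
Qed.

(** Invariance of an array, as a function of its slots in [A], under the
    orthogonal group of the diagonal form [s]: the third clause is invariance
    under the reflections in coordinate hyperplanes, the second under the
    infinitesimal rotations [s_a E_ab - s_b E_ba]. *)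
Definition invariant_on A F :=
  [/\ forall i j, {in A, i =1 j} -> F i = F j,
      forall a b i, lie A a b F i = s a * s b * lie A b a F i
    & forall a i, odd (count A i a) -> F i = 0].

Lemma lie_linear A a b x F G i :
  lie A a b (x *: F + G) i = x * lie A a b F i + lie A a b G i.
Proof.
rewrite /lie mulr_sumr -big_split; apply: eq_bigr => k _ /=.
by rewrite mulrCA -mulrDr.
Qed.

Lemma invariant_on0 A : invariant_on A 0.
Proof.
by split=> // a b i; rewrite /lie !big1 ?mulr0 // => k _; rewrite mulr0.
Qed.

Lemma invariant_onP A x F G :
  invariant_on A F -> invariant_on A G -> invariant_on A (x *: F + G).
Proof.
move=> [F1 F2 F3] [G1 G2 G3]; have E i : (x *: F + G) i = x * F i + G i by [].
split=> [i j ij | a b i | a i oi].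
- by rewrite !E (F1 _ _ ij) (G1 _ _ ij).
- by rewrite !lie_linear F2 G2 mulrDr mulrCA.
- by rewrite E (F3 _ _ oi) (G3 _ _ oi) mulr0 addr0.
Qed.

Definition pair_factor k l : array := fun i => (i k == i l)%:R * s (i k).

Definition contract k l F : array := fun i => \sum_a s a * F (upd (upd i k a) l a).

Section TwoSlots.
Variables (k l : D) (A : {set D}).
Hypotheses (kl : k != l) (kA : k \in A) (lA : l \in A).
Let A' := (A :\ k :\ l)%SET.

Lemma big_two_slots (f : D -> R) :
  \sum_(x in A) f x = f k + (f l + \sum_(x in A') f x).
Proof.
rewrite (big_setD1 k) // (big_setD1 l) //=.
by rewrite !inE eq_sym kl lA.
Qed.

Lemma count_two_slots i a :
  count A i a = ((i k == a) + ((i l == a) + count A' i a))%N.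
Proof.
have E B : count B i a = (\sum_(x in B) (i x == a))%N.
  rewrite /count -sum1_card big_mkcond [RHS]big_mkcond; apply: eq_bigr => x _.
  by rewrite !inE; case: (x \in B) => //=; case: eqP.
rewrite !E (big_setD1 k) // (big_setD1 l) //=.
by rewrite !inE eq_sym kl lA.
Qed.

Lemma slot_neq x : x \in A' -> (x != k) * (x != l).
Proof. by rewrite !inE => /and3P[-> -> _]. Qed.

(** The factor is the tensor of the form in the two slots; being the form that
    the group preserves, it is annihilated by the infinitesimal rotations, and it
    adds an even number to every count. *)
Lemma invariant_pair_factor G :
  invariant_on A' G -> invariant_on A (fun i => pair_factor k l i * G i).
Proof.
move=> [G1 G2 G3].
have A'A : {subset A' <= A} by move=> x; rewrite !inE => /and3P[].
have Gk i a : G (upd i k a) = G i.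
  by apply: G1 => x xA; rewrite upd_out // slot_neq.
have Gl i a : G (upd i l a) = G i.
  by apply: G1 => x xA; rewrite upd_out // slot_neq.
split=> [i j ij | a b i | a i].
- by rewrite /pair_factor !ij //; congr (_ * _); apply: G1 => x /A'A /ij.
- have E c d : lie A c d (fun i => pair_factor k l i * G i) i =
      (i k == c)%:R * (i l == d)%:R * s d * G i
      + (i l == c)%:R * (i k == d)%:R * s d * G i
      + pair_factor k l i * lie A' c d G i.
    rewrite /lie big_two_slots addrA; congr (_ + _ + _).
    + rewrite /pair_factor upd_in upd_out 1?eq_sym // Gk [d == _]eq_sym.
      by rewrite !mulrA.
    + rewrite /pair_factor upd_in upd_out // Gl.
      by rewrite !mulrA; case: (eqVneq (i k) d) => [->|_] //; rewrite !mulr0 !mul0r.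
    + rewrite mulr_sumr; apply: eq_bigr => x /slot_neq[xk xl].
      by rewrite /pair_factor !upd_out 1?eq_sym // mulrCA.
  rewrite !E (G2 a b i).
  by have := s2 a; have := s2 b; move: (s a) (s b) => u v v2 u2; ring: u2 v2.
- rewrite count_two_slots /pair_factor; have [->|] := eqVneq (i k) (i l).
    by rewrite addnA addnn oddD odd_double => /G3 ->; rewrite mulr0.
  by move=> _; rewrite !mul0r.
Qed.

(** Contraction commutes with the action on the other slots; on the contracted
    slots the correction [s_c F (d, c) + s_c F (c, d)] satisfies the second clause
    by itself. *)
Lemma invariant_contract F : invariant_on A F -> invariant_on A' (contract k l F).
Proof.
move=> [F1 F2 F3]; split=> [i j ij | a b i | a i oi].
- apply: eq_bigr => c _; congr (_ * _); apply: F1 => x xA; rewrite !ffunE.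
  have [//|xl] := eqVneq x l; have [//|xk] := eqVneq x k.
  by apply: ij; rewrite !inE xl xk.
- pose ii c d := upd (upd i k c) l d.
  have iik c d : ii c d k = c by rewrite /ii upd_out // upd_in.
  have iil c d : ii c d l = d by rewrite /ii upd_in.
  have upk c d m : upd (ii c d) k m = ii m d.
    by rewrite /ii updC 1?eq_sym // upd_upd.
  have upl c d m : upd (ii c d) l m = ii c m by rewrite /ii upd_upd.
  have E c d : lie A' c d (contract k l F) i =
      \sum_m s m * lie A c d F (ii m m) - s c * F (ii d c) - s c * F (ii c d).
    rewrite -addrA -opprD -mulrDr; apply/eqP; rewrite eq_sym subr_eq; apply/eqP.
    rewrite [in LHS]/lie.
    under eq_bigr => m _ do rewrite big_two_slots addrA mulrDr.
    rewrite big_split /= addrC; congr (_ + _).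
      rewrite [RHS]/lie; under eq_bigr => m _ do rewrite mulr_sumr.
      rewrite exchange_big; apply: eq_bigr => x /slot_neq[xk xl].
      rewrite mulr_sumr; apply: eq_bigr => m _; rewrite mulrCA.
      by rewrite /ii !upd_out // (updC _ _ _ xk) (updC _ _ _ xl).
    rewrite (bigD1 c) //= [X in _ + X]big1 ?addr0 => [|m mc].
      by rewrite iik iil upk upl eqxx !mul1r.
    by rewrite iik iil (negPf mc) !mul0r addr0 mulr0.
  rewrite !E !mulrBr; have -> : \sum_m s m * lie A a b F (ii m m) =
      s a * s b * \sum_m s m * lie A b a F (ii m m).
    by rewrite mulr_sumr; apply: eq_bigr => m _; rewrite F2 mulrCA.
  rewrite !(mulrA _ (s b)) -(mulrA (s a) (s b) (s b)) s2 mulr1.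
  by rewrite -!addrA; congr (_ + _); rewrite addrC.
- apply: big1 => m _; rewrite (F3 a) ?mulr0 //.
  rewrite count_two_slots upd_out // !upd_in addnA addnn oddD odd_double /=.
  congr odd: oi; apply: eq_card => x; rewrite !inE.
  have [//|xl] := eqVneq x l; have [//|xk] := eqVneq x k.
  by rewrite !upd_out.
Qed.

End TwoSlots.

(** The Casimir identity.  Invariance turns [|E_ba H|^2] into
    [s_a s_b <E_ab H, E_ba H>]; moving one operator across by [replace_adjoint]
    and summing over [a] and [b], a pair of equal slots contributes [<H, H>], and a
    pair of distinct slots the contraction of [H] in these slots. *)
Lemma square_lie_invariant A H : invariant_on A H ->
  \sum_a \sum_b dot (lie A b a H) (lie A b a H) =
  #|A|%:R * dot H H
  + \sum_(k in A) \sum_(l in A | l != k)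
      dot H (fun i => pair_factor k l i * contract k l H i).
Proof.
move=> [_ H2 _].
have E k l : \sum_a \sum_b s a * s b *
      (\sum_(i : index) (i k == a)%:R * H (upd i k b) *
                        ((i l == b)%:R * H (upd i l a))) =
    if l == k then dot H H
    else dot H (fun i => pair_factor k l i * contract k l H i).
  under eq_bigr => a _ do under eq_bigr => b _ do rewrite replace_adjoint.
  under eq_bigr => a _ do under eq_bigr => b _ do rewrite mulr_sumr.
  under eq_bigr => a _ do rewrite exchange_big /=.
  rewrite exchange_big /=.
  have [->|lk] := eqVneq l k; apply: eq_bigr => i _.
    rewrite (bigD1 (i k)) //= (bigD1 (i k)) //= !upd_in eqxx !mul1r s2 mul1r.
    rewrite !upd_upd upd_id // [X in _ + X + _]big1 => [|b bi]; last first.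
      by rewrite eq_sym (negPf bi) !mul0r mulr0.
    rewrite big1 ?addr0 // => a ai; apply: big1 => b _; rewrite upd_in.
    have [<-|] := eqVneq a b; last by rewrite !mul0r !mulr0.
    by rewrite eq_sym (negPf ai) !mul0r mulr0.
  rewrite /pair_factor /contract !mulr_sumr; apply: eq_bigr => a _.
  rewrite (bigD1 (i k)) //= big1 ?addr0 => [|b bi]; last first.
    by rewrite eq_sym (negPf bi) !mul0r mulr0.
  rewrite eqxx upd_out // [i l == _]eq_sym mul1r.
  have ac (u v x y z : R) : u * v * (x * (z * y)) = x * (z * v * (u * y)).
    by ring.
  exact: ac.
transitivity (\sum_a \sum_b s a * s b *
    \sum_(i : index) lie A a b H i * lie A b a H i).
  apply: eq_bigr => a _; apply: eq_bigr => b _; rewrite mulr_sumr.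
  by apply: eq_bigr => i _; rewrite {1}H2 !mulrA [s b * _]mulrC.
transitivity (\sum_(k in A) \sum_(l in A) if l == k then dot H H
    else dot H (fun i => pair_factor k l i * contract k l H i)).
  under [RHS]eq_bigr => k _ do under eq_bigr => l _ do rewrite -E.
  under [RHS]eq_bigr => k _ do rewrite exchange_big /=.
  rewrite [RHS]exchange_big /=; apply: eq_bigr => a _.
  under [RHS]eq_bigr => k _ do rewrite exchange_big /=.
  rewrite [RHS]exchange_big /=; apply: eq_bigr => b _.
  under [RHS]eq_bigr => k _ do rewrite -mulr_sumr.
  rewrite -mulr_sumr; congr (_ * _).
  under [RHS]eq_bigr => k _ do rewrite exchange_big /=.
  rewrite [RHS]exchange_big /=; apply: eq_bigr => i _.
  rewrite /lie mulr_suml; apply: eq_bigr => k _.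
  by rewrite mulr_sumr.
rewrite -[#|A|]sum1_card natr_sum mulr_suml -big_split /=.
apply: eq_bigr => k kA; rewrite (bigD1 k) //= eqxx mul1r; congr (_ + _).
by apply: eq_bigr => l /andP[_ /negPf ->].
Qed.

End Arrays.

(** * The first fundamental theorem for diagonal forms *)

Section Pairings.
Variables (R : realFieldType) (D I : finType) (s : I -> R).
Hypothesis s2 : forall a, s a * s a = 1.

Local Notation index := {ffun D -> I}.
Local Notation array := (index -> R^o).
Implicit Types (k l : D) (F G H : array) (A : {set D}) (m : seq (D * D)).

Definition slots m : seq D := flatten [seq [:: p.1; p.2] | p <- m].

Definition pairing_array m : array := fun i => \prod_(p <- m) pair_factor s p.1 p.2 i.

Definition pairs_up A m := uniq (slots m) /\ A =i slots m.

Definition pairing_arrays A : set array :=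
  [set pairing_array m | m in [set m | pairs_up A m]].

Lemma pairing_array_cons k l m i :
  pairing_array ((k, l) :: m) i = pair_factor s k l i * pairing_array m i.
Proof. exact: big_cons. Qed.

Lemma pairs_up_cons A k l m : k != l -> k \in A -> l \in A ->
  pairs_up (A :\ k :\ l)%SET m -> pairs_up A ((k, l) :: m).
Proof.
move=> kl kA lA [um Am]; split=> [|x].
  by rewrite /= !inE (negPf kl) -!Am !inE !eqxx /= andbF um.
rewrite !inE -Am !inE /=.
have [->|_] := eqVneq x k; first by rewrite kA.
by have [->|_] := eqVneq x l; first by rewrite lA.
Qed.

Lemma invariant_pairing A m : pairs_up A m -> invariant_on s A (pairing_array m).
Proof.
elim: m A => [|[k l] m IH] A [um Am].
  have -> : pairing_array [::] = fun=> 1 by apply: funext => i; rewrite /pairing_array big_nil.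
  have -> : A = finset.set0 by apply/setP => x; rewrite Am finset.in_set0.
  split=> // [a b i | a i]; first by rewrite /lie !big_set0 mulr0.
  by rewrite /count (eq_card0 (_ : _ =i pred0)) // => x; rewrite !inE.
have -> : pairing_array ((k, l) :: m) =
          fun i => pair_factor s k l i * pairing_array m i.
  by apply: funext => i; exact: pairing_array_cons.
move: um; rewrite /= inE negb_or => /and3P[/andP[kl km] lm um].
have [kA lA] : k \in A /\ l \in A by rewrite !Am !inE !eqxx !orbT.
apply: invariant_pair_factor => //; apply: IH; split => // x.
rewrite !inE Am !inE /=; have [->|_] := eqVneq x l; first by rewrite (negPf lm).
by have [->|_] := eqVneq x k; first by rewrite (negPf km).
Qed.

Lemma pairing_arrays_pair A k l F : k != l -> k \in A -> l \in A ->
    lspan (pairing_arrays (A :\ k :\ l)%SET) F ->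
  lspan (pairing_arrays A) (fun i => pair_factor s k l i * F i : R^o).
Proof.
move=> kl kA lA; move: F; apply: lspan_ind.
- suff -> : (fun i => pair_factor s k l i * (0 : array) i : R^o) = 0.
    exact: lspan0.
  by apply: funext => i; rewrite mulr0.
- move=> a F G PF PG.
  rewrite [X in lspan _ X](_ : _ = a *: (fun i => pair_factor s k l i * F i : R^o) +
      (fun i => pair_factor s k l i * G i : R^o)); first exact: lspanP.
  by apply: funext => i; rewrite /= mulrDr [X in X + _]mulrCA.
- move=> _ [m Am <-]; apply: sub_lspan; exists ((k, l) :: m).
    exact: pairs_up_cons.
  by apply: funext => i; rewrite pairing_array_cons.
Qed.

(** [E_aa] multiplies the entry at [i] by the number of slots of [i] equal to
    [a].  By invariance under reflections this number [c] is even wherever the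
    entry is not zero, so that [c ^ 2 >= 2 c]; these numbers add up to [#|A|]. *)
Lemma square_lie_ge A H : invariant_on s A H ->
  2 * #|A|%:R * dot H H <= \sum_a \sum_b dot (lie A b a H) (lie A b a H).
Proof.
move=> [_ _ H3]; apply: (@le_trans _ _ (\sum_a dot (lie A a a H) (lie A a a H))).
  rewrite /dot exchange_big mulr_sumr; apply: ler_sum => i _ /=.
  have E a : lie A a a H i = (count A i a)%:R * H i.
    rewrite /lie /count -sum1_card natr_sum mulr_suml big_mkcond [RHS]big_mkcond.
    apply: eq_bigr => k _; rewrite !inE; case: (k \in A) => //=.
    by case: eqP => [ia|]; rewrite ?mul0r // upd_id.
  under eq_bigr => a _ do rewrite E mulrACA.
  rewrite -mulr_suml; have [->|Hi] := eqVneq (H i) 0; first by rewrite !mulr0.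
  apply: ler_wpM2r; first by rewrite -expr2 sqr_ge0.
  rewrite -(sum_count A i) natr_sum mulr_sumr; apply: ler_sum => a _.
  rewrite -!natrM ler_nat.
  case: (count A i a) (H3 a i) => [//|[|c]] Hc; last by rewrite leq_mul2r orbT.
  by move: Hi; rewrite Hc ?eqxx.
apply: ler_sum => a _; rewrite (bigD1 a) //= lerDl.
by apply: sumr_ge0 => b _; exact: dot_ge0.
Qed.

(** Subtract from the array its orthogonal projection to the span of the
    pairings.  The remainder [H] is invariant and its contractions are spanned by
    pairings, by induction, so that the cross terms of [square_lie_invariant]
    vanish on [H]; comparison with [square_lie_ge] leaves [H = 0]. *)
Theorem invariant_pairings A F :
  invariant_on s A F -> lspan (pairing_arrays A) F.
Proof.
move En : #|A| => n; elim/ltn_ind: n => n IH in A F En *.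
move=> invF; pose W := lspan (pairing_arrays A).
have sW : subspace W by split; [exact: lspan0 | move=> a u v; exact: lspanP].
have [|G WG GE] := @riesz_representation _ _ W (dot F) sW.
  by move=> a x y _ _; rewrite dot_linr.
pose H : array := (- 1) *: G + F.
have HW w : W w -> dot H w = 0.
  by move=> Ww; rewrite dot_linl GE // mulN1r addNr.
suff H0 : H = 0.
  suff -> : F = G by [].
  by apply/eqP; rewrite -subr_eq0 addrC -scaleN1r -/H H0.
have invH : invariant_on s A H.
  apply: invariant_onP => //; move: G WG {GE H HW}; apply: lspan_ind.
  - exact: invariant_on0.
  - by move=> a u v; exact: invariant_onP.
  - by move=> _ [m Am <-]; exact: invariant_pairing.
(* with no slot left, [H] is constant and orthogonal to the empty pairing, 1 *)
have [A0|A0] := eqVneq A finset.set0.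
  have [H1 _ _] := invH; apply: funext => i; apply/eqP.
  have /HW /eqP : W (pairing_array [::]).
    by apply: sub_lspan; exists [::] => //; split => // x; rewrite A0 finset.in_set0.
  rewrite /dot (eq_bigr (fun=> H i)) => [|j _]; last first.
    by rewrite /pairing_array big_nil mulr1; apply: H1 => x; rewrite A0 finset.in_set0.
  rewrite sumr_const mulrn_eq0 => /orP[/eqP/card0_eq /(_ i)|//].
  by rewrite !inE.
have cross k l : k \in A -> l \in A -> l != k ->
    dot H (fun i => pair_factor s k l i * contract s k l H i) = 0.
  move=> kA lA lk; apply: HW; apply: pairing_arrays_pair; rewrite 1?eq_sym //.
  apply: (IH #|(A :\ k :\ l)%SET|) => //; last first.
    by apply: invariant_contract; rewrite 1?eq_sym.
  rewrite -En (cardsD1 k A) kA (cardsD1 l (A :\ k)%SET) !inE lk lA /=.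
  exact: leqnSn.
have cA : (0 : R) < #|A|%:R by rewrite ltr0n card_gt0.
have := square_lie_ge invH.
rewrite (square_lie_invariant s2 invH) [X in _ + X]big1 ?addr0 => [|k kA]; last first.
  by apply: big1 => l /andP[lA lk]; exact: cross.
rewrite -mulrA mulr_natl mulr2n gerDl pmulr_rle0 // => le0.
by apply: dot_eq0; apply/eqP; rewrite eq_le le0 dot_ge0.
Qed.

End Pairings.

(** * Infinitesimal invariance from rational rotations *)

Section PolynomialLemmas.
Variable R : realFieldType.

Lemma deriv_prod (J : eqType) (r : seq J) (f : J -> {poly R}) : uniq r ->
  (\prod_(k <- r) f k)^`() =
  \sum_(k <- r) (f k)^`() * \prod_(l <- r | l != k) f l.
Proof.
elim: r => [_|k r IH /= /andP[kr ur]]; first by rewrite !big_nil derivC.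
rewrite !big_cons derivM IH // eqxx /=; congr (_ + _).
  congr (_ * _); rewrite big_seq [RHS]big_seq_cond; apply: eq_bigl => l.
  by have [->|] := eqVneq l k; rewrite ?(negPf kr) ?andbF ?andbT.
rewrite mulr_sumr; apply: eq_big_seq => l lr.
rewrite big_cons; have -> : k != l by apply: contraNneq kr => ->.
by rewrite mulrCA.
Qed.

Lemma poly_eq0_natr (p : {poly R}) : (forall t, (2 <= t)%N -> p.[t%:R] = 0) -> p = 0.
Proof.
move=> p0; apply/eqP/negPn/negP => pn0.
pose rs := [seq t.+2%:R : R | t <- iota 0 (size p)].
have rs_root : all (root p) rs by apply/allP => _ /mapP[t _ ->]; apply/rootP/p0.
have rs_uniq : uniq rs.
  by rewrite map_inj_uniq ?iota_uniq // => t u /eqP; rewrite eqr_nat => /eqP[].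
by have := max_poly_roots pn0 rs_root rs_uniq; rewrite size_map size_iota ltnn.
Qed.

End PolynomialLemmas.

Section Group.
Variables (R : realFieldType) (D I : finType) (s : I -> R).
Hypothesis s2 : forall a, s a * s a = 1.

Local Notation index := {ffun D -> I}.
Local Notation array := (index -> R^o).
Implicit Types (a b x y : I) (M : I -> I -> R) (F : array).

Definition act M F : array :=
  fun i => \sum_(j : index) (\prod_k M (i k) (j k)) * F j.

Definition orthogonal_matrix M :=
  forall x y, \sum_c M x c * s c * M y c = (x == y)%:R * s x.

Lemma prod_diag (g : I -> R) (i j : index) :
  \prod_k ((i k == j k)%:R * g (i k)) = (i == j)%:R * \prod_k g (i k).
Proof.
rewrite big_split /=; have [<-|ij] := eqVneq i j.
  by rewrite (big1 _ _ (fun k => (i k == i k)%:R)) // => k _; rewrite eqxx.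
suff [k ik] : exists k, i k != j k by rewrite (bigD1 k) //= (negPf ik) !mul0r.
by apply/existsP; apply: contraNT ij => /existsPn H; apply/eqP/ffunP => k; apply/eqP/negPn/H.
Qed.

Lemma act_diag (g : I -> R) F i :
  act (fun x y => (x == y)%:R * g x) F i = (\prod_k g (i k)) * F i.
Proof.
rewrite /act (bigD1 i) //= prod_diag eqxx mul1r [X in _ + X]big1 ?addr0 // => j ji.
by rewrite prod_diag eq_sym (negPf ji) !mul0r.
Qed.

Section Rotation.
Variables (a b : I).
Hypothesis ab : a != b.
Let kappa := s a * s b.
Let swap x := if x == a then b else if x == b then a else x.

(** The numerators, over the denominator [1 + kappa t^2], of the rational
    parametrization of the rotations (circular for [kappa = 1], hyperbolic for
    [kappa = -1]) of the coordinate plane of [a] and [b]. *)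
Definition rotation_num (t : R) x y :=
  (1 + kappa * t ^+ 2 - 2 * kappa * t ^+ 2 * ((x == a)%:R + (x == b)%:R))
    * (x == y)%:R
  + 2 * t * ((x == a)%:R - kappa * (x == b)%:R) * (swap x == y)%:R.

Let den (t : R) := 1 + kappa * t ^+ 2.

Definition rotation t x y := rotation_num t x y / den t.

Lemma kappa2 : kappa * kappa = 1.
Proof. by rewrite /kappa mulrACA !s2 mulr1. Qed.

Lemma rotation_num_sum t x (f : I -> R) :
  \sum_c rotation_num t x c * f c =
  (1 + kappa * t ^+ 2 - 2 * kappa * t ^+ 2 * ((x == a)%:R + (x == b)%:R)) * f x
  + 2 * t * ((x == a)%:R - kappa * (x == b)%:R) * f (swap x).
Proof.
have delta z (u : R) : \sum_c u * (z == c)%:R * f c = u * f z.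
  rewrite (bigD1 z) //= eqxx mulr1 big1 ?addr0 // => c cz.
  by rewrite eq_sym (negPf cz) mulr0 mul0r.
rewrite -!delta -big_split; apply: eq_bigr => c _.
by rewrite /rotation_num mulrDl.
Qed.

Lemma rotation_num_orthogonal t x y :
  \sum_c rotation_num t x c * (s c * rotation_num t y c) =
  (x == y)%:R * s x * den t ^+ 2.
Proof.
have ba : (b == a) = false by rewrite eq_sym (negPf ab).
rewrite rotation_num_sum /rotation_num /den /swap.
have k2 := kappa2.
have ka : kappa * s a = s b by rewrite /kappa mulrAC s2 mul1r.
case: (eqVneq x a) => [-> | xa]; [|case: (eqVneq x b) => [-> | xb]].
all: case: (eqVneq y a) => [ya | ya]; [|case: (eqVneq y b) => [yb | yb]].
all: rewrite ?ya ?yb ?eqxx ?ba ?(negPf ab) ?(eq_sym a) ?(eq_sym b) ?(eq_sym y).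
all: rewrite ?(negPf ya) ?(negPf yb) ?(negPf xa) ?(negPf xb) /=.
all: rewrite -?ka; move: kappa k2 {ka} => k k2; ring: k2.
Qed.



Lemma rotation_orthogonal t : den t != 0 -> orthogonal_matrix (rotation t).
Proof.
move=> d0 x y; apply: (mulIf (expf_neq0 2 d0)).
rewrite -rotation_num_orthogonal mulr_suml; apply: eq_bigr => c _.
by rewrite /rotation; field.
Qed.

(** For [kappa = -1] the denominator vanishes at [1]. *)
Lemma den_neq0 (t : nat) : (2 <= t)%N -> den t%:R != 0.
Proof.
move=> t2; rewrite /den; apply/eqP => /eqP; rewrite addrC addr_eq0 => /eqP kt.
have : (t ^ 4)%:R = 1%:R :> R.
  have kt2 : (kappa * t%:R ^+ 2) ^+ 2 = 1 by rewrite kt sqrrN expr1n.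
  by rewrite natrX -[RHS]kt2 exprMn [kappa ^+ 2]expr2 kappa2 mul1r -exprM.
move=> /eqP; rewrite eqr_nat => /eqP t4.
by have := leq_exp2r 2 t (erefl : (0 < 4)%N); rewrite t4 t2.
Qed.


(** The identity expressing invariance under the rotations is polynomial in the
    parameter once denominators are cleared, so it can be differentiated at
    [0]. *)
Lemma lie_invariant_rotation F :
    (forall t, den t != 0 -> act (rotation t) F = F) ->
  forall i, lie [set: D]%SET a b F i = kappa * lie [set: D]%SET b a F i.
Proof.
move=> invF i.
(* the coefficients of [t] and [t ^ 2] in the numerators *)
pose N x y : R := 2 * ((x == a)%:R - kappa * (x == b)%:R) * (swap x == y)%:R.
pose Z x y : R := kappa * (1 - 2 * ((x == a)%:R + (x == b)%:R)) * (x == y)%:R.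
pose Q x y : {poly R} := (x == y)%:R%:P + (N x y)%:P * 'X + (Z x y)%:P * 'X ^+ 2.
have QE x y t : (Q x y).[t] = rotation_num t x y.
  by rewrite !(hornerD, hornerM, hornerC, hornerX, hornerXn) /rotation_num /N /Z; ring.
have dQ x y : (Q x y)^`().[0] = N x y.
  by rewrite !derivE !hornerE /=.
pose P := \sum_(j : index) (\prod_k Q (i k) (j k)) * (F j)%:P
          - (1 + kappa%:P * 'X ^+ 2) ^+ #|D| * (F i)%:P.
have P0 : P = 0.
  apply: poly_eq0_natr => t /den_neq0 d0.
  have hE := (hornerD, hornerM, hornerC, hornerXn, horner_exp, horner_prod).
  apply/eqP; rewrite hornerD hornerN subr_eq0 horner_sum !hE.
  rewrite -{2}(invF _ d0) /act mulr_sumr; apply/eqP; apply: eq_bigr => j _.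
  rewrite !hE [RHS]mulrA; congr (_ * _).
  rewrite -prodr_const -big_split; apply: eq_bigr => k _ /=.
  by rewrite QE hornerX -expr2 -/(den _) /rotation [RHS]mulrC divfK.
have : P^`().[0] = 0 by rewrite P0 derivC horner0.
have -> : P^`().[0] = \sum_(j : index) (\sum_k N (i k) (j k) *
    \prod_(l | l != k) (i l == j l)%:R) * F j.
  rewrite derivB derivM derivC mulr0 addr0 hornerD hornerN hornerM deriv_exp.
  rewrite hornerMn hornerM derivD derivC add0r derivM derivC mul0r add0r.
  rewrite hornerM derivXn hornerMn hornerXn expr1 mul0rn mulr0 mul0r mul0rn mul0r subr0.
  rewrite raddf_sum horner_sum; apply: eq_bigr => j _ /=.
  rewrite derivM derivC mulr0 addr0 hornerM hornerC deriv_prod ?index_enum_uniq //.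
  congr (_ * _); rewrite horner_sum; apply: eq_bigr => k _.
  rewrite hornerM dQ horner_prod; congr (_ * _); apply: eq_bigr => l _.
  by rewrite !(hornerD, hornerM, hornerC, hornerX, hornerXn) !mulr0 !addr0.
under eq_bigr => j _ do rewrite mulr_suml.
rewrite exchange_big /= => sum0.
have E k : \sum_(j : index) N (i k) (j k) * \prod_(l | l != k) (i l == j l)%:R * F j =
    2 * ((i k == a)%:R * F (upd i k b) - kappa * ((i k == b)%:R * F (upd i k a))).
  transitivity (\sum_y N (i k) y * F (upd i k y)).
    rewrite [RHS](reindex_onto (fun j : index => j k) (fun y => upd i k y)) /=; last first.
      by move=> y _; rewrite upd_in.
    rewrite [RHS]big_mkcond; apply: eq_bigr => j _; case: eqP => [ij|ij].
      rewrite -ij big1 ?mulr1 ?ij // => l lk.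
      by rewrite -ij upd_out // eqxx.
    suff [l lk il] : exists2 l, l != k & i l != j l.
      by rewrite (bigD1 l) //= (negPf il) !mul0r mulr0 mul0r.
    apply/exists_inP; apply: contra_notT ij => /exists_inPn ij.
    apply/ffunP => x; rewrite ffunE; case: eqP => [->//|/eqP xk].
    by apply/eqP/negPn/ij.
  rewrite (bigD1 (swap (i k))) //= big1 ?addr0 => [|y yk]; last first.
    by rewrite /N [_ == y]eq_sym (negPf yk) mulr0 mul0r.
  rewrite /N eqxx mulr1 /swap; case: (eqVneq (i k) a) => [ika|_].
    by rewrite ika (negPf ab) /=; ring.
  by case: eqVneq => _ /=; ring.
move: sum0; under eq_bigr => k _ do rewrite E.
rewrite -mulr_sumr sumrB -mulr_sumr => /eqP.
rewrite mulf_eq0 pnatr_eq0 /= subr_eq0 => /eqP.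
have T (f : D -> R) : \sum_(k in [set: D]%SET) f k = \sum_k f k.
  by apply: eq_bigl => k; rewrite finset.in_setT.
by rewrite /lie !T.
Qed.

End Rotation.

Lemma reflection_orthogonal (g : I -> R) : (forall x, g x * g x = 1) ->
  orthogonal_matrix (fun x y => (x == y)%:R * g x).
Proof.
move=> g2 x y; rewrite (bigD1 x) //= eqxx mul1r [X in _ + X]big1 => [|c cx].
  rewrite addr0 eq_sym; have [->|_] := eqVneq x y; last by rewrite !mul0r mulr0.
  by rewrite !mul1r mulrAC g2 mul1r.
by rewrite eq_sym (negPf cx) !mul0r.
Qed.

Theorem invariant_on_of_group F :
    (forall M, orthogonal_matrix M -> act M F = F) ->
  invariant_on s [set: D]%SET F.
Proof.
move=> invF; split=> [i j ij | a b i | a i oi].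
- by congr F; apply/ffunP => x; apply: ij; rewrite finset.in_setT.
- have [<-|ab] := eqVneq a b; first by rewrite s2 mul1r.
  apply: lie_invariant_rotation => // t t0.
  exact/invF/rotation_orthogonal.
pose g x : R := (-1) ^+ (x == a).
have g2 x : g x * g x = 1 by rewrite -expr2 sqrr_sign.
have := invF _ (reflection_orthogonal g2).
move=> /(congr1 (@^~ i)); rewrite act_diag.
have -> : \prod_k g (i k) = -1.
  rewrite /g.
  rewrite prodrXr -signr_odd; suff -> : (\sum_k (i k == a) = count [set: D] i a)%N.
    by rewrite oi expr1.
  rewrite /count -sum1_card [RHS]big_mkcond; apply: eq_bigr => k _.
  by rewrite !inE; case: eqP.
by move=> E; lra.
Qed.

End Group.

(** * Orthonormal bases *)

Section OrthonormalBasis.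
Variables (R : realType) (V : vectType R) (eps : {symmetric V}).
Hypothesis eps_nondeg : nondegenerate eps.
Implicit Types (u v w : V).

Lemma form_symC u v : eps u v = eps v u.
Proof. by rewrite hermC expr0 mul1r. Qed.

Lemma nondegenerate_eq0 u : (forall v, eps u v = 0) -> u = 0.
Proof.
move=> u0; apply/eqP; rewrite -memv0 -(eqP (eps_nondeg : _ == _)).
by apply/mem_orthovP => v _; exact: u0.
Qed.

Definition orthonormal_seq (b : seq V) :=
  forall i j, (i < size b)%N -> (j < size b)%N ->
    if i == j then eps b`_i b`_i ^+ 2 = 1 else eps b`_i b`_j = 0.

Lemma orthonormal_rcons b u : orthonormal_seq b ->
    (forall i, (i < size b)%N -> eps u b`_i = 0) -> eps u u != 0 ->
  exists v, orthonormal_seq (rcons b v).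
Proof.
move=> ob ub uu; pose r := Num.sqrt `|eps u u|.
have r2 : r ^+ 2 = `|eps u u| by rewrite sqr_sqrtr.
exists (r^-1 *: u) => i j; rewrite size_rcons !ltnS !nth_rcons => ib jb.
have [{}ib|bi] := ltnP i; have [{}jb|bj] := ltnP j; first exact: ob.
- have -> : j = size b by apply/eqP; rewrite eqn_leq bj jb.
  by rewrite eqxx (ltn_eqF ib) /= form_symC linearZl_LR /= ub // mulr0.
- have -> : i = size b by apply/eqP; rewrite eqn_leq bi ib.
  by rewrite eqxx (gtn_eqF jb) /= linearZl_LR /= ub // mulr0.
- have -> : j = size b by apply/eqP; rewrite eqn_leq bj jb.
  have -> : i = size b by apply/eqP; rewrite eqn_leq bi ib.
  rewrite eqxx linearZl_LR linearZr_LR /= mulrA -expr2 exprMn exprVn r2.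
  by rewrite exprVn real_normK ?num_real // mulVf // expf_neq0.
Qed.

(** The projection to the orthogonal of a shorter orthonormal family does not
    vanish and, the form being nondegenerate, neither does the form on its
    image; polarization then gives a vector to normalize. *)
Lemma orthonormal_extend b : orthonormal_seq b -> (size b < \dim {:V})%N ->
  exists v, orthonormal_seq (rcons b v).
Proof.
move=> ob ltb; pose P v := v - \sum_(i < size b) (eps b`_i b`_i * eps v b`_i) *: b`_i.
have Pb v j : (j < size b)%N -> eps (P v) b`_j = 0.
  move=> jb; rewrite /P linearBl linear_sumlz /= (bigD1 (Ordinal jb)) //= big1 => [|i ij].
    have := ob j j jb jb; rewrite eqxx expr2 linearZl_LR /= mulrAC => ->.
    by rewrite mul1r addr0 subrr.
  have := ob i j (ltn_ord i) jb; rewrite -val_eqE /= in ij.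
  by rewrite (negPf ij) linearZl_LR /= => ->; rewrite mulr0.
have PP v w : eps (P v) (P w) = eps (P v) w.
  rewrite {2}/P linearBr linear_sumr big1 ?subr0 // => i _.
  by rewrite linearZr_LR /= Pb // mulr0.
have P0 : exists v, P v != 0.
  apply: contrapT => noP; move: ltb; rewrite ltnNge => /negP; apply.
  apply: leq_trans (dim_span b); apply: dimvS; apply/subvP => v _.
  have /eqP : P v = 0 by apply: contrapT => /eqP Pv; apply: noP; exists v.
  rewrite subr_eq0 => /eqP ->; apply: memv_suml => i _; apply: memvZ.
  exact/memv_span/mem_nth.
have PD v w : P (v + w) = P v + P w.
  rewrite /P addrACA -opprD -big_split /=; congr (_ - _); apply: eq_bigr => i _.
  by rewrite linearDl /= mulrDr scalerDl.
move: P Pb PP P0 PD => P Pb PP P0 PD.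
have [v Pv] : exists v, eps (P v) (P v) != 0.
  apply: contrapT => noP; have [v /eqP[]] := P0.
  have P00 w : eps (P w) (P w) = 0.
    by apply/eqP/negPn/negP => Pw; apply: noP; exists w.
  apply: nondegenerate_eq0 => w; have := P00 (v + w).
  rewrite PD linearDl !linearDr /= !P00 add0r addr0 (form_symC (P w)) PP => /eqP.
  by rewrite -mulr2n mulrn_eq0 => /eqP.
by apply: (orthonormal_rcons ob _ Pv) => i; exact: Pb.
Qed.

Lemma orthonormal_free b : orthonormal_seq b -> free b.
Proof.
move=> ob; apply/(@freeP _ _ _ (in_tuple b)) => k k0 i.
have := congr1 (eps^~ b`_i) k0; rewrite linear0l linear_sumlz /= (bigD1 i) //=.
rewrite big1 ?addr0 => [|j ji]; last first.
  rewrite linearZl_LR /=; have := ob j i (ltn_ord j) (ltn_ord i).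
  by rewrite -val_eqE /= in ji; rewrite (negPf ji) => ->; rewrite mulr0.
rewrite linearZl_LR /= => /eqP; rewrite mulf_eq0 => /orP[/eqP //|/eqP bi].
have := ob i i (ltn_ord i) (ltn_ord i); rewrite eqxx bi expr0n /= => /eqP.
by rewrite eq_sym oner_eq0.
Qed.

Lemma exists_orthonormal_basis n : n = \dim {:V} ->
  exists (b : n.-tuple V) (s : 'I_n -> R),
    [/\ basis_of {:V} b, forall a, s a * s a = 1
      & forall i j, eps (tnth b i) (tnth b j) = (i == j)%:R * s i].
Proof.
move=> En; have [b [ob sb]] : exists b, orthonormal_seq b /\ size b = n.
  have: (n <= \dim {:V})%N by rewrite En.
  elim: n {En} => [|n IH] ltn; first by exists [::].
  have [b [ob sb]] := IH (ltnW ltn).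
  have [v ov] : exists v, orthonormal_seq (rcons b v).
    by apply: orthonormal_extend => //; rewrite sb.
  by exists (rcons b v); rewrite size_rcons sb.
have bE (i : 'I_n) : tnth (Tuple (introT eqP sb)) i = b`_i by exact: tnth_nth.
have lti (i : 'I_n) : (i < size b)%N by rewrite sb.
exists (Tuple (introT eqP sb)), (fun i => eps b`_i b`_i); split => [|i|i j].
- by rewrite basisEfree orthonormal_free //= subvf sb En /=.
- by have := ob i i (lti i) (lti i); rewrite eqxx expr2.
- have := ob i j (lti i) (lti j); rewrite !bE -val_eqE /=.
  by case: eqP => [<-|_ ->]; rewrite ?mul1r ?mul0r.
Qed.

End OrthonormalBasis.

(** * Contractions in coordinates *)

Section Multilinear.
Variables (R : realType) (V : vectType R).

Lemma scalar_sum (f : V -> R) (I : finType) (c : I -> R) (v : I -> V) :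
  scalar f -> f (\sum_a c a *: v a) = \sum_a c a * f (v a).
Proof.
move=> lf; have f0 : f 0 = 0.
  have := lf 1 0 0; rewrite scaler0 addr0 mul1r => /eqP.
  by rewrite -subr_eq0 opprD addNKr oppr_eq0 => /eqP.
by elim/big_rec2: _ => // a y z _ <-; rewrite lf.
Qed.

(** Induction on a list of the slots whose coefficients are not a Kronecker
    delta: both sides are linear in the coefficients of each slot. *)
Lemma multilinear_expand k (t : cotensor V k) (I : finType) (v : I -> V)
    (c : 'I_k -> I -> R) : multilinear t ->
  t (fun j => \sum_a c j a *: v a) =
  \sum_(y : {ffun 'I_k -> I}) (\prod_j c j (y j)) * t (fun j => v (y j)).
Proof.
move=> mt; pose delta a : I -> R := fun b => (a == b)%:R.
have deltaE a : \sum_b delta a b *: v b = v a.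
  rewrite (bigD1 a) //= /delta eqxx scale1r big1 ?addr0 // => b ba.
  by rewrite eq_sym (negPf ba) scale0r.
suff: forall r : seq 'I_k, forall c : 'I_k -> I -> R,
    (forall j, j \notin r -> exists a, c j = delta a) ->
  t (fun j => \sum_a c j a *: v a) =
  \sum_(y : {ffun 'I_k -> I}) (\prod_j c j (y j)) * t (fun j => v (y j)).
  by move=> /(_ (enum 'I_k) c); apply => j; rewrite mem_enum.
elim=> [|j r IH] {}c cr.
  pose i := [ffun j => sval (cid (cr j isT))].
  have ci j : c j = delta (i j) by rewrite ffunE; exact: (svalP (cid (cr j isT))).
  have -> : (fun j => \sum_a c j a *: v a) = (fun j => v (i j)).
    by apply: funext => j; rewrite ci deltaE.
  rewrite (bigD1 i) //= [X in _ + X]big1 ?addr0 => [|y yi].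
    by rewrite big1 ?mul1r // => j _; rewrite ci /delta eqxx.
  suff [j ij] : exists j, i j != y j.
    by rewrite (bigD1 j) //= ci /delta (negPf ij) !mul0r.
  apply/existsP; apply: contraNT yi => /existsPn H.
  by apply/eqP/ffunP => j; apply/esym/eqP/negPn/H.
pose c' a j' := if j' == j then delta a else c j'.
have tE a : t (fun j => \sum_b c' a j b *: v b) =
    \sum_(y : {ffun 'I_k -> I}) (\prod_j c' a j (y j)) * t (fun j => v (y j)).
  apply: IH => j' j'r; rewrite /c'; have [_|j'j] := eqVneq j' j; first by exists a.
  by apply: cr; rewrite inE negb_or j'j.
transitivity (\sum_a c j a * t (fun j => \sum_b c' a j b *: v b)).
  pose x j := \sum_b c j b *: v b.
  rewrite -[LHS]/(t x).
  have dE u : (fun j' => if j' == j then u else x j') =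
      @dfwith _ (fun=> (V : Type)) x j u.
    apply: funext => j'; have [->|jj] := eqVneq; first by rewrite dfwith_in.
    by rewrite dfwith_out // eq_sym.
  have -> : x = @dfwith _ (fun=> (V : Type)) x j (\sum_b c j b *: v b).
    by rewrite -dE; apply: funext => j'; case: eqP => [->|].
  rewrite (scalar_sum (f := fun u => t (@dfwith _ (fun=> (V : Type)) x j u))) //.
  apply: eq_bigr => a _; congr (_ * t _); rewrite -dE; apply: funext => j'.
  by rewrite /c' /x; case: eqP => // _; rewrite deltaE.
under eq_bigr => a _ do rewrite tE mulr_sumr.
rewrite exchange_big; apply: eq_bigr => y _ /=.
under eq_bigr => a _ do rewrite mulrA.
rewrite -mulr_suml; congr (_ * _).
rewrite [RHS](bigD1 j) //= (bigD1 (y j)) //= [X in _ + X]big1 ?addr0 => [|a ay].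
  rewrite (bigD1 j) //= {1}/c' eqxx /delta eqxx mul1r; congr (_ * _).
  by apply: eq_bigr => j' /negPf jj; rewrite /c' jj.
by rewrite (bigD1 j) //= {1}/c' eqxx /delta (negPf ay) mul0r mulr0.
Qed.

End Multilinear.

Section Pairs.
Variables (R : comNzRingType) (l : nat).

Definition pair_slot (p : 'I_(2 * l) * bool) : 'I_(4 * l) :=
  if p.2 then pair_snd p.1 else pair_fst p.1.

Lemma half_slot_subproof (j : 'I_(4 * l)) : (j./2 < 2 * l)%N.
Proof.
by case: j => j lj /=; rewrite -divn2 ltn_divLR // -mulnA (mulnC l) mulnA.
Qed.

Definition slot_pair (j : 'I_(4 * l)) : 'I_(2 * l) * bool :=
  (Ordinal (half_slot_subproof j), odd j).

Lemma pair_slotK : cancel pair_slot slot_pair.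
Proof.
move=> [k []]; congr (_, _); rewrite /= ?mul2n ?odd_double //; apply: val_inj => /=.
  by rewrite mul2n uphalf_double.
by rewrite mul2n doubleK.
Qed.

Lemma slot_pairK : cancel slot_pair pair_slot.
Proof.
move=> j; apply: val_inj; rewrite /pair_slot /=; have := odd_double_half j.
by case: odd; rewrite /= mul2n.
Qed.

Lemma prod_pairs (f : 'I_(4 * l) -> R) :
  \prod_j f j = \prod_k (f (pair_fst k) * f (pair_snd k)).
Proof.
rewrite (reindex pair_slot) /=; last first.
  by exists slot_pair => ? _; [exact: pair_slotK | exact: slot_pairK].
rewrite -(pair_bigA _ (fun k b => f (pair_slot (k, b)))) /=.
by apply: eq_bigr => k _; rewrite big_bool mulrC.
Qed.

Lemma sum_prod_pairs (I : finType) (G : 'I_(2 * l) -> I -> I -> R) :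
  \sum_(i : {ffun 'I_(4 * l) -> I}) \prod_k G k (i (pair_fst k)) (i (pair_snd k)) =
  \prod_k \sum_a \sum_b G k a b.
Proof.
under [RHS]eq_bigr => k _ do rewrite pair_bigA /=.
rewrite bigA_distr_bigA /=.
pose h (f : {ffun 'I_(2 * l) -> I * I}) : {ffun 'I_(4 * l) -> I} :=
  [ffun j => let p := slot_pair j in if p.2 then (f p.1).2 else (f p.1).1].
have hfst f k : h f (pair_fst k) = (f k).1.
  by rewrite ffunE -[pair_fst k]/(pair_slot (k, false)) pair_slotK.
have hsnd f k : h f (pair_snd k) = (f k).2.
  by rewrite ffunE -[pair_snd k]/(pair_slot (k, true)) pair_slotK.
rewrite (reindex h); first by apply: eq_bigr => f _; apply: eq_bigr => k _; rewrite hfst hsnd.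
exists (fun i : {ffun 'I_(4 * l) -> I} => [ffun k => (i (pair_fst k), i (pair_snd k))]) => [f _|i _].
  by apply/ffunP => k; rewrite ffunE hfst hsnd; case: (f k).
apply/ffunP => j; rewrite ffunE -[in RHS](slot_pairK j).
by case: (slot_pair j) => k [] /=; rewrite ffunE.
Qed.

End Pairs.

Section Contraction.
Variables (R : realType) (V : vectType R) (l n : nat).
Implicit Types (K : 'I_(2 * l) -> 'I_n -> 'I_n -> R) (C : 'M[R]_n).

Definition contraction K (e : 'I_n -> V) (sigma : 'S_(4 * l))
    (t : cotensor V (4 * l)) : R :=
  \sum_(i : {ffun 'I_(4 * l) -> 'I_n})
    (\prod_k K k (i (pair_fst k)) (i (pair_snd k))) * t (fun j => e (i (sigma j))).

(** Contravariant coefficients [K'] and covariant vectors [e'] change by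
    contragredient matrices. *)
Lemma contraction_change_basis C K K' (e e' : 'I_n -> V) sigma t :
    multilinear t -> (forall a, e' a = \sum_x C a x *: e x) ->
    (forall k x y, K k x y = \sum_a \sum_b K' k a b * (C a x * C b y)) ->
  contraction K' e' sigma t = contraction K e sigma t.
Proof.
move=> mt e'E KE.
have tE (i : {ffun 'I_(4 * l) -> 'I_n}) : t (fun j => e' (i (sigma j))) =
    \sum_(z : {ffun 'I_(4 * l) -> 'I_n})
      (\prod_j C (i j) (z j)) * t (fun j => e (z (sigma j))).
  rewrite (_ : (fun j => _) = (fun j => \sum_x C (i (sigma j)) x *: e x)); last first.
    by apply: funext => j; rewrite e'E.
  rewrite (multilinear_expand e (fun j => C (i (sigma j)))) //.
  rewrite (reindex (fun z : {ffun 'I_(4 * l) -> 'I_n} =>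
    [ffun j => z (sigma j)] : {ffun 'I_(4 * l) -> 'I_n})) /=; last first.
    exists (fun z : {ffun 'I_(4 * l) -> 'I_n} => [ffun j => z (sigma^-1%g j)]) => z _;
    by apply/ffunP => j; rewrite !ffunE ?permK ?permKV.
  apply: eq_bigr => z _; congr (_ * t _); last by apply: funext => j; rewrite ffunE.
  by rewrite [RHS](reindex_perm sigma) /=; apply: eq_bigr => j _; rewrite ffunE.
rewrite /contraction; under eq_bigr => i _ do rewrite tE mulr_sumr.
rewrite exchange_big; apply: eq_bigr => z _ /=.
under eq_bigr => i _ do rewrite mulrA prod_pairs -big_split /=.
rewrite -mulr_suml; congr (_ * _).
under [RHS]eq_bigr => k _ do rewrite KE.
exact: (sum_prod_pairs (fun k a b => K' k a b *
  (C a (z (pair_fst k)) * C b (z (pair_snd k))))).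
Qed.

Lemma sym2_sumE (J : finType) (f : J -> sym2 V) x :
  sym2_val (\sum_j f j) x = \sum_j sym2_val (f j) x.
Proof.
have -> : sym2_val (\sum_j f j) = \sum_j sym2_val (f j).
  exact: (raddf_sum (\val : {additive sym2 V -> cotensor V 2})).
by rewrite fct_sumE.
Qed.

Lemma sym2_scaleE c (f : sym2 V) x : sym2_val (c *: f) x = c * sym2_val f x.
Proof. by []. Qed.

Variables (eps : {symmetric V}) (hl : (0 < l)%N).

(** The dual pair of covectors evaluated at [x] takes the place of the last
    inverse Gram entry, which makes [P1] a full contraction. *)
Definition P1_coef (e : n.-tuple V) (x : 'I_2 -> V) k a b : R :=
  if k == last_pair hl then
    2^-1 * (coord e a (x 0) * coord e b (x 1) + coord e b (x 0) * coord e a (x 1))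
  else invmx (gram eps e) a b.

Lemma P1_contraction (e : n.-tuple V) sigma (eta : curvature_tensor V l) x :
  sym2_val (P1 eps e hl sigma eta) x = contraction (P1_coef e x) (tnth e) sigma eta.
Proof.
rewrite /P1 sym2_sumE; apply: eq_bigr => i _.
rewrite sym2_scaleE [in RHS](bigD1 (last_pair hl)) //= {1}/P1_coef eqxx mulrC mulrA.
congr (_ * _ * _); apply: eq_bigr => k /negPf kl.
by rewrite /P1_coef kl.
Qed.

Lemma P2_contraction (e : n.-tuple V) sigma (eta : curvature_tensor V l) x :
  sym2_val (P2 eps e sigma eta) x =
  contraction (fun _ => invmx (gram eps e)) (tnth e) sigma eta * eps (x 0) (x 1).
Proof. by []. Qed.

Lemma coord_expand (e : n.-tuple V) v : basis_of {:V} e ->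
  v = \sum_a coord e a v *: tnth e a.
Proof.
move=> he; rewrite [LHS](coord_basis he) ?memvf //.
by apply: eq_bigr => a _; rewrite (tnth_nth 0).
Qed.

Lemma multilinear_curvature (eta : curvature_tensor V l) :
  multilinear (curvature_val eta).
Proof.
case: eta => t /= /asboolP; apply: lspan_ind => [i x a u v|a u v|_ [A hA <-]].
- by rewrite -[RHS]/(a * 0 + 0) mulr0 addr0.
- exact: multilinear_comb.
move=> i x c u v.
have i4 : (i %/ 4 < l)%N by rewrite ltn_divLR // [(l * 4)%N]mulnC ltn_ord.
have im : (i %% 4 < 4)%N by rewrite ltn_mod.
pose a0 := Ordinal i4; pose j0 := Ordinal im.
have iE : slot a0 j0 = i by apply: val_inj; rewrite /= mulnC -divn_eq.
have slot_inj a j : slot a j = i -> a = a0.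
  move=> /(congr1 val) /= E; apply: val_inj.
  by rewrite /= -E mulnC divnMDl // divn_small ?addn0.
have E w : tensor_prod A (@dfwith _ _ x i w) =
    A a0 (@dfwith _ (fun=> (V : Type)) (fun j => x (slot a0 j)) j0 w) *
    \prod_(a < l | a != a0) A a (fun j => x (slot a j)).
  rewrite /tensor_prod (bigD1 a0) //=; congr (_ * _).
    congr (A a0 _); apply: funext => j; have [<-|jj] := eqVneq j0 j.
      by rewrite iE !dfwith_in.
    rewrite !dfwith_out // -iE; apply: contraNneq jj => /(congr1 val) /= /eqP.
    by rewrite eqn_add2l.
  apply: eq_bigr => a aa; congr (A a _); apply: funext => j.
  by rewrite dfwith_out //; apply: contraNneq aa => /esym /slot_inj ->.
have [mA _] := hA a0.
by rewrite !E mA mulrDl mulrA.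
Qed.

End Contraction.

(** * Independence of the basis and equivariance *)

Section BasisIndependence.
Variables (R : realType) (V : vectType R) (eps : {symmetric V}).
Variables (l n : nat) (hl : (0 < l)%N).
Implicit Types (b e : n.-tuple V) (s : 'I_n -> R).

Definition orthonormal_basis b s :=
  [/\ basis_of {:V} b, forall a, s a * s a = 1
    & forall i j, eps (tnth b i) (tnth b j) = (i == j)%:R * s i].

Lemma sym2_ext (f g : sym2 V) : (forall x, sym2_val f x = sym2_val g x) -> f = g.
Proof. by move=> fg; apply: val_inj; apply: funext. Qed.

Lemma gram_orthonormal b s : orthonormal_basis b s ->
  gram eps b = diag_mx (\row_i s i).
Proof.
by case=> _ _ H; apply/matrixP => i j; rewrite !mxE H mulr_natl eq_sym.
Qed.

(** The Gram matrix is diagonal with entries of square 1. *)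
Lemma invmx_gram_orthonormal b s : orthonormal_basis b s ->
  gram eps b \in unitmx /\ invmx (gram eps b) = gram eps b.
Proof.
move=> ob; have G2 : gram eps b *m gram eps b = 1%:M.
  rewrite (gram_orthonormal ob) mulmx_diag -diag_const_mx; congr diag_mx.
  by apply/rowP => i; rewrite !mxE; case: ob.
have [Gu _] := mulmx1_unit G2; split => //.
by rewrite -[LHS]mulmx1 -G2 mulKmx.
Qed.

Lemma coord_tnth e i j : basis_of {:V} e -> coord e j (tnth e i) = (i == j)%:R.
Proof.
by move=> he; rewrite (tnth_nth 0) coord_free ?(basis_free he) // eq_sym.
Qed.

Lemma form_sum u v (J J' : finType) (c : J -> R) (d : J' -> R) (f : J -> V) (g : J' -> V) :
  u = \sum_j c j *: f j -> v = \sum_j d j *: g j ->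
  eps u v = \sum_i \sum_j c i * d j * eps (f i) (g j).
Proof.
move=> -> ->; rewrite linear_sumlz; apply: eq_bigr => i _ /=.
rewrite linear_sumr; apply: eq_bigr => j _ /=.
by rewrite linearZl_LR linearZr_LR /= mulrA.
Qed.

Section Change.
Variables (b e : n.-tuple V) (s : 'I_n -> R).
Hypotheses (ob : orthonormal_basis b s) (he : basis_of {:V} e).
Let hb : basis_of {:V} b. Proof. by case: ob. Qed.
Let C : 'M[R]_n := \matrix_(i, j) coord b j (tnth e i).

Lemma coord_change v x : coord b x v = \sum_a coord e a v * C a x.
Proof.
rewrite {1}(coord_expand v he) linear_sum; apply: eq_bigr => a _.
by rewrite linearZ mxE.
Qed.

Lemma invmx_gram_change : invmx (gram eps b) = C^T *m invmx (gram eps e) *m C.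
Proof.
have [Gu _] := invmx_gram_orthonormal ob.
have [Cu _] : C \in unitmx /\ (\matrix_(i, j) coord e j (tnth b i) : 'M[R]_n) \in unitmx.
  apply: mulmx1_unit; apply/matrixP => i j; rewrite !mxE -(coord_tnth i j he).
  rewrite [in RHS](coord_expand (tnth e i) hb) linear_sum; apply: eq_bigr => a _.
  by rewrite linearZ !mxE.
have GE : gram eps e = C *m gram eps b *m C^T.
  apply/matrixP => i j; rewrite !mxE.
  rewrite (form_sum (coord_expand _ hb) (coord_expand _ hb)) exchange_big.
  apply: eq_bigr => y _ /=; rewrite !mxE mulr_suml; apply: eq_bigr => x _.
  by rewrite !mxE mulrAC.
have CTu : C^T \in unitmx by rewrite unitmx_tr.
have Eu : gram eps e \in unitmx by rewrite GE !unitmx_mul Cu Gu.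
have CG : C *m gram eps b = gram eps e *m invmx C^T by rewrite GE mulmxK.
apply: (can_inj (mulmxK Gu)).
by rewrite mulVmx // -!mulmxA CG mulKmx // mulmxV.
Qed.

Lemma invmx_gram_changeE x y : invmx (gram eps b) x y =
  \sum_i \sum_j invmx (gram eps e) i j * (C i x * C j y).
Proof.
rewrite invmx_gram_change mxE exchange_big; apply: eq_bigr => j _ /=.
by rewrite mxE mulr_suml; apply: eq_bigr => i _; rewrite !mxE; ring.
Qed.

Lemma basis_change a : tnth e a = \sum_x C a x *: tnth b x.
Proof.
by rewrite {1}(coord_expand (tnth e a) hb); apply: eq_bigr => x _; rewrite mxE.
Qed.

Lemma P2_basis_independent sigma (eta : curvature_tensor V l) :
  P2 eps e sigma eta = P2 eps b sigma eta.
Proof.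
apply: sym2_ext => x; rewrite !P2_contraction; congr (_ * _).
apply: (@contraction_change_basis _ _ _ _ C).
- exact: multilinear_curvature.
- exact: basis_change.
- by move=> _; exact: invmx_gram_changeE.
Qed.

Lemma P1_basis_independent sigma (eta : curvature_tensor V l) :
  P1 eps e hl sigma eta = P1 eps b hl sigma eta.
Proof.
apply: sym2_ext => x; rewrite !P1_contraction.
apply: (@contraction_change_basis _ _ _ _ C).
- exact: multilinear_curvature.
- exact: basis_change.
move=> k y z; rewrite /P1_coef; case: eqP => _; last exact: invmx_gram_changeE.
rewrite !(coord_change _ y) !(coord_change _ z) !big_distrlr /=.
rewrite [X in _ + X]exchange_big -big_split mulr_sumr.
apply: eq_bigr => i _; rewrite -big_split mulr_sumr; apply: eq_bigr => j _ /=.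
by ring.
Qed.

End Change.

Section Equivariance.
Variables (b : n.-tuple V) (s : 'I_n -> R) (g : 'End(V)).
Hypotheses (ob : orthonormal_basis b s) (og : orthogonal_group eps g).
Let hb : basis_of {:V} b. Proof. by case: ob. Qed.
Let gb := map_tuple g b.

Lemma orthonormal_basis_map : orthonormal_basis gb s.
Proof.
have [_ s2 bE] := ob; have [/eqP g0 gi] := og; split=> // [|i j]; last first.
  by rewrite !tnth_map gi bE.
have fullg : basis_of (g @: {:V}) (map g b).
  by apply: limg_basis_of => //; rewrite g0 capv0.
have [_ fg] := andP fullg.
by rewrite basisEfree (fg : free gb) subvf (size_basis hb) size_tuple /=.
Qed.

Lemma coord_map a v : coord gb a (g v) = coord b a v.
Proof.
have [hgb _ _] := orthonormal_basis_map.
rewrite {1}(coord_expand v hb) !linear_sum (bigD1 a) //= !linearZ /=.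
rewrite -tnth_map coord_tnth // eqxx mulr1 big1 ?addr0 // => i ia.
by rewrite linearZ linearZ /= -tnth_map coord_tnth // (negPf ia) mulr0.
Qed.

Lemma gram_map : gram eps gb = gram eps b.
Proof. by rewrite (gram_orthonormal ob) (gram_orthonormal orthonormal_basis_map). Qed.

Lemma contraction_pullback K sigma (eta : curvature_tensor V l) :
  contraction K (tnth b) sigma (curvature_pullback g eta) =
  contraction K (tnth gb) sigma eta.
Proof.
apply: eq_bigr => i _; congr (_ * _); rewrite /= /pullback.
by congr (curvature_val eta _); apply: funext => j; rewrite tnth_map.
Qed.

Lemma sym2_pullbackE (f : sym2 V) x :
  sym2_val (sym2_pullback g f) x = sym2_val f (fun i => g (x i)).
Proof. by []. Qed.

Lemma P2_equivariant sigma (eta : curvature_tensor V l) :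
  P2 eps b sigma (curvature_pullback g eta) = sym2_pullback g (P2 eps b sigma eta).
Proof.
have [hgb _ _] := orthonormal_basis_map.
rewrite -[in RHS](P2_basis_independent ob hgb).
apply: sym2_ext => x; rewrite sym2_pullbackE !P2_contraction.
rewrite contraction_pullback gram_map; congr (_ * _).
by have [_ ->] := og.
Qed.

Lemma P1_equivariant sigma (eta : curvature_tensor V l) :
  P1 eps b hl sigma (curvature_pullback g eta) = sym2_pullback g (P1 eps b hl sigma eta).
Proof.
have [hgb _ _] := orthonormal_basis_map.
rewrite -[in RHS](P1_basis_independent ob hgb).
apply: sym2_ext => x; rewrite sym2_pullbackE !P1_contraction contraction_pullback.
congr contraction; apply: funext => k; apply: funext => y; apply: funext => z.
by rewrite /P1_coef gram_map !coord_map.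
Qed.

End Equivariance.

Lemma contraction_linear K (e : 'I_n -> V) sigma a (u v : curvature_tensor V l) :
  contraction K e sigma (a *: u + v) =
  a * contraction K e sigma u + contraction K e sigma v.
Proof.
rewrite /contraction mulr_sumr -big_split; apply: eq_bigr => i _ /=.
by rewrite mulrCA -mulrDr.
Qed.

Lemma P2_linear (b : n.-tuple V) sigma : linear (P2 eps b (l := l) sigma).
Proof.
move=> a u v; apply: sym2_ext => x.
rewrite -[RHS]/(a * sym2_val (P2 eps b sigma u) x + sym2_val (P2 eps b sigma v) x).
by rewrite !P2_contraction contraction_linear mulrDl mulrA.
Qed.

Lemma P1_linear (b : n.-tuple V) sigma : linear (P1 eps b hl (l := l) sigma).
Proof.
move=> a u v; apply: sym2_ext => x.
rewrite -[RHS]/(a * sym2_val (P1 eps b hl sigma u) x + sym2_val (P1 eps b hl sigma v) x).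
by rewrite !P1_contraction contraction_linear.
Qed.

(** Pulling the argument back along [g] amounts to computing the contraction in
    the orthonormal basis [g b], and the contractions do not depend on the basis. *)
Lemma span_equivariant (b e : n.-tuple V) s : orthonormal_basis b s ->
    basis_of {:V} e ->
  forall phi, lspan ([set P1 eps e hl sigma | sigma in [set: 'S_(4 * l)]]
           `|` [set P2 eps e sigma | sigma in [set: 'S_(4 * l)]]) phi ->
    equivariant_maps eps l phi.
Proof.
move=> ob he; apply: lspan_ind.
- split=> [a u v | g og eta]; first by rewrite scaler0 addr0.
  by apply: sym2_ext.
- move=> a f h [lf ef] [lh eh]; split=> [c u v | g og eta].
    rewrite -[LHS]/(a *: f _ + h _) lf lh -[f u]/(f u) /=.
    by rewrite -![(a *: f + h) _]/(a *: f _ + h _) !scalerDr !scalerA (mulrC a) addrACA.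
  rewrite -[LHS]/(a *: f _ + h _) ef // eh //.
  exact: sym2_ext.
- move=> _ [[sigma _ <-]|[sigma _ <-]]; split; [exact: P1_linear| |exact: P2_linear|].
    by move=> g og eta; rewrite !(P1_basis_independent ob he) (P1_equivariant ob og).
  by move=> g og eta; rewrite !(P2_basis_independent ob he) (P2_equivariant ob og).
Qed.

End BasisIndependence.

(** * From pairings to permutations *)

Section ExtractPair.
Variables (R : realFieldType) (D I : finType) (s : I -> R).
Implicit Types (k l : D) (A : {set D}) (m : seq (D * D)).

Lemma pair_factorC k l (i : {ffun D -> I}) : pair_factor s k l i = pair_factor s l k i.
Proof.
by rewrite /pair_factor eq_sym; case: eqP => [->|]; rewrite ?mul0r.
Qed.

Lemma pairs_up_consP A k l m : pairs_up A ((k, l) :: m) ->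
  [/\ k != l, k \in A, l \in A & pairs_up (A :\ k :\ l)%SET m].
Proof.
move=> [um Am]; move: um.
rewrite /= inE negb_or => /and3P[/andP[kl km] lm um].
split; rewrite ?Am ?inE ?eqxx ?orbT //; split => // x.
rewrite !inE Am !inE /=; have [->|_] := eqVneq x l; first by rewrite (negPf lm).
by have [->|_] := eqVneq x k; first by rewrite (negPf km).
Qed.

Lemma extract_pair A k m : pairs_up A m -> k \in A ->
  exists l m1, [/\ l != k, l \in A, pairs_up (A :\ k :\ l)%SET m1
    & forall i, pairing_array s m i = pair_factor s k l i * pairing_array s m1 i].
Proof.
elim: m A => [|[a b] m IH] A Am kA.
  by have [_ A0] := Am; move: kA; rewrite A0.
have [ab aA bA Am'] := pairs_up_consP Am.
have [->|ka] := eqVneq k a.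
  by exists b, m; rewrite eq_sym; split => // i; rewrite pairing_array_cons.
have [->|kb] := eqVneq k b.
  exists a, m; split => // [|i]; last by rewrite pairing_array_cons pair_factorC.
  suff -> : (A :\ b :\ a = A :\ a :\ b)%SET by [].
  by apply/setP => x; rewrite !inE andbCA.
have [|l [m1 [lk lA Am1 E]]] := IH _ Am' _; first by rewrite !inE ka kb.
move: (lA); rewrite !inE => /and3P[lb la lA'].
exists l, ((a, b) :: m1); split => // [|i]; last first.
  by rewrite !pairing_array_cons E mulrCA.
apply: pairs_up_cons => //.
- by rewrite !inE aA [a == l]eq_sym [a == k]eq_sym la ka.
- by rewrite !inE bA [b == l]eq_sym [b == k]eq_sym lb kb.
- suff -> : (A :\ k :\ l :\ a :\ b = A :\ a :\ b :\ k :\ l)%SET by [].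
  apply/setP => x; rewrite !inE.
  by do 4! case: (x == _) => //=.
Qed.

Lemma size_slots m : size (slots m) = (2 * size m)%N.
Proof. by elim: m => //= p m ->; rewrite mulnS. Qed.

Lemma nth_slots x0 y0 m (k : nat) : (k < size m)%N ->
  nth x0 (slots m) (2 * k) = (nth y0 m k).1 /\
  nth x0 (slots m) (2 * k).+1 = (nth y0 m k).2.
Proof.
elim: m k => // p m IH [_|k /IH[<- <-]]; first by rewrite muln0.
by rewrite mulnSr addn2.
Qed.

End ExtractPair.

Section Permutation.
Variable l : nat.
Implicit Type m : seq ('I_(4 * l) * 'I_(4 * l)).

Lemma size_pairs_up m : pairs_up [set: 'I_(4 * l)]%SET m -> size m = (2 * l)%N.
Proof.
move=> [um Am]; have : size (slots m) = (4 * l)%N.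
  rewrite -(card_uniqP um) -[RHS]card_ord; apply: eq_card => x.
  by rewrite -Am finset.in_setT.
rewrite size_slots => E; apply/eqP.
by rewrite -(eqn_pmul2l (isT : (0 < 2)%N)) E mulnA.
Qed.

(** The permutation lists the slots of the pairing in order. *)
Lemma perm_of_pairs m : pairs_up [set: 'I_(4 * l)]%SET m ->
  exists tau : 'S_(4 * l), forall x0 (k : 'I_(2 * l)),
    tau (pair_fst k) = (nth x0 m k).1 /\ tau (pair_snd k) = (nth x0 m k).2.
Proof.
move=> Am; have sm := size_pairs_up Am; have [um _] := Am.
have ss : size (slots m) = (4 * l)%N by rewrite size_slots sm mulnA.
(* the default value [j] is never reached *)
pose f (j : 'I_(4 * l)) := nth j (slots m) j.
have fE x (j : 'I_(4 * l)) : f j = nth x (slots m) j.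
  by apply: set_nth_default; rewrite ss.
have f_inj : injective f.
  move=> i j; rewrite (fE i i) (fE i j) => /eqP.
  by rewrite nth_uniq ?ss // => /eqP/val_inj.
exists (perm f_inj) => x0 k; rewrite !permE !(fE x0.1).
by apply: nth_slots; rewrite sm.
Qed.

Lemma prod_but_last (R : comNzRingType) N (lt : (N.-1 < N)%N) (F : nat -> R) :
  \prod_(k < N | k != Ordinal lt) F k = \prod_(k < N.-1) F k.
Proof.
case: N lt => // N lt; rewrite big_mkcond big_ord_recr /= -val_eqE /= eqxx mulr1.
by apply: eq_bigr => k _; rewrite -val_eqE /= neq_ltn ltn_ord.
Qed.

End Permutation.

Section Contraction.
Variables (R : realType) (V : vectType R) (l n : nat).

(** The contraction defined by [sigma] joins the slots [sigma^-1 (2k)] and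
    [sigma^-1 (2k + 1)] of the tensor. *)
Lemma contraction_perm (K : 'I_(2 * l) -> 'I_n -> 'I_n -> R) (e : 'I_n -> V) tau t :
  contraction K e (tau^-1)%g t =
  \sum_(i : {ffun 'I_(4 * l) -> 'I_n})
    (\prod_k K k (i (tau (pair_fst k))) (i (tau (pair_snd k)))) * t (fun j => e (i j)).
Proof.
rewrite /contraction (reindex (fun i : {ffun 'I_(4 * l) -> 'I_n} =>
    [ffun j => i (tau j)] : {ffun 'I_(4 * l) -> 'I_n})) /=; last first.
  exists (fun z : {ffun 'I_(4 * l) -> 'I_n} => [ffun j => z (tau^-1%g j)]) => z _;
  by apply/ffunP => j; rewrite !ffunE ?permK ?permKV.
apply: eq_bigr => i _; congr (_ * t _).
  by apply: eq_bigr => k _; rewrite !ffunE.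
by apply: funext => j; rewrite ffunE permKV.
Qed.

End Contraction.

(** * Kernels given by pairings *)

Section PairingValue.
Variables (R : realType) (V : vectType R) (eps : {symmetric V}).
Variables (l n : nat) (hl : (0 < l)%N) (b : n.-tuple V) (s : 'I_n -> R).
Hypothesis ob : orthonormal_basis eps b s.
Let s2 a : s a * s a = 1. Proof. by case: ob. Qed.
Let hb : basis_of {:V} b. Proof. by case: ob. Qed.

Local Notation D1 := 'I_(4 * l).
Local Notation D := (D1 + 'I_2)%type.
Local Notation index1 := {ffun D1 -> 'I_n}.
Local Notation index2 := {ffun 'I_2 -> 'I_n}.
Implicit Types (i : index1) (c : index2) (eta : curvature_tensor V l).

Definition components eta : index1 -> R^o :=
  fun i => curvature_val eta (fun j => tnth b (i j)).

Definition basis_pair c : 'I_2 -> V := fun k => tnth b (c k).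

Definition swap_index c : index2 := [ffun k => c (if k == 0 then 1 else 0)].

Definition join_index i c : {ffun D -> 'I_n} :=
  [ffun x => match x with inl k => i k | inr k => c k end].

Definition weight i : R := \prod_k s (i k).

(** The value at a pair of basis vectors of the map with kernel [G]; the weight
    raises the indices of [eta]. *)
Definition kernel_value (G : {ffun D -> 'I_n} -> R^o) eta c : R :=
  \sum_i weight i * G (join_index i c) * components eta i.

Definition P_maps : set (curvature_tensor V l -> sym2 V) :=
  [set P1 eps b hl sigma | sigma in [set: 'S_(4 * l)]]
           `|` [set P2 eps b sigma | sigma in [set: 'S_(4 * l)]].

Lemma invmx_gramE x y : invmx (gram eps b) x y = (x == y)%:R * s x.
Proof.
have [_ ->] := invmx_gram_orthonormal ob.
by rewrite mxE; case: ob => _ _ ->.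
Qed.

Lemma pairs_inl (m : seq (D * D)) : (forall x, x \in slots m -> exists k, x = inl k) ->
  exists m' : seq (D1 * D1), m = [seq (inl p.1, inl p.2) | p <- m'].
Proof.
elim: m => [_|[x y] m IH xm]; first by exists [::].
have [|m' ->] := IH _; first by move=> z zm; apply: xm; rewrite /= !inE zm !orbT.
have [k ->] := xm x (mem_head _ _).
have [k' ->] : exists k', y = inl k' by apply: xm; rewrite /= !inE eqxx orbT.
by exists ((k, k') :: m').
Qed.

Lemma slots_inl (m : seq (D1 * D1)) :
  slots [seq (inl p.1, inl p.2) : D * D | p <- m] = map inl (slots m).
Proof. by elim: m => // p m IH /=; congr [:: _, _ & _]. Qed.

Lemma pairing_array_inl (m : seq (D1 * D1)) i c :
  pairing_array s [seq (inl p.1, inl p.2) : D * D | p <- m] (join_index i c) =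
  pairing_array s m i.
Proof.
rewrite /pairing_array big_map; apply: eq_bigr => p _.
by rewrite /pair_factor !ffunE.
Qed.

(** Reindexing along [tau] groups the weight by pairs; in each pair it then
    cancels, by [weight_pair_factor]. *)
Lemma weight_perm (tau : 'S_(4 * l)) i :
  weight i = \prod_k (s (i (tau (pair_fst k))) * s (i (tau (pair_snd k)))).
Proof.
rewrite /weight (reindex_perm tau) /= -(prod_pairs (fun j => s (i (tau j)))).
by [].
Qed.

Lemma weight_pair_factor k k' i :
  s (i k) * s (i k') * pair_factor s k k' i = pair_factor s k k' i.
Proof.
rewrite /pair_factor; case: eqP => [->|]; last by rewrite mul0r mulr0.
by rewrite s2 !mul1r.
Qed.

(** Slots of the value paired with each other: a multiple of the form. *)
Let x0 : D1 * D1 := (pair_fst (last_pair hl), pair_fst (last_pair hl)).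

Lemma kernel_value_P2 (m : seq (D1 * D1)) (G : {ffun D -> 'I_n} -> R^o) :
    pairs_up [set: D1]%SET m ->
    (forall i c, G (join_index i c) =
       (c 0 == c 1)%:R * s (c 0) * pairing_array s m i) ->
  exists2 Theta, lspan P_maps Theta & forall eta c,
    sym2_val (Theta eta) (basis_pair c) =
    2^-1 * (kernel_value G eta c + kernel_value G eta (swap_index c)).
Proof.
move=> Am GE; have [tau tauE] := perm_of_pairs Am.
exists (P2 eps b (tau^-1)%g); first by apply: sub_lspan; right; exists (tau^-1)%g.
move=> eta c; rewrite P2_contraction contraction_perm.
have wE i : weight i * pairing_array s m i =
    \prod_k invmx (gram eps b) (i (tau (pair_fst k))) (i (tau (pair_snd k))).
  rewrite (weight_perm tau) /pairing_array (big_nth x0) (size_pairs_up Am) big_mkord.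
  rewrite -big_split; apply: eq_bigr => k _ /=.
  have [<- <-] := tauE x0 k.
  by rewrite weight_pair_factor invmx_gramE.
have E c' : kernel_value G eta c' = (c' 0 == c' 1)%:R * s (c' 0) *
    \sum_(i : index1) weight i * pairing_array s m i * components eta i.
  rewrite /kernel_value mulr_sumr; apply: eq_bigr => i _.
  by rewrite GE mulrCA -!mulrA.
rewrite !E !ffunE /= [c 1 == _]eq_sym.
have -> : eps (basis_pair c 0) (basis_pair c 1) = (c 0 == c 1)%:R * s (c 0).
  by have [_ _ ->] := ob.
under [in RHS]eq_bigr => i _ do rewrite wE.
rewrite mulrC; case: eqP => [->|_]; last by rewrite !mul0r addr0 mulr0.
by field.
Qed.

Lemma P1_coef_last c i k k' :
  P1_coef eps hl b (basis_pair c) (last_pair hl) (i k) (i k') =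
  2^-1 * ((c 0 == i k)%:R * (c 1 == i k')%:R + (c 1 == i k)%:R * (c 0 == i k')%:R).
Proof.
by rewrite /P1_coef eqxx /basis_pair !coord_tnth // [X in _ + X]mulrC.
Qed.

(** Slots of the value paired with two slots of the argument: the last
    contraction is replaced by a symmetric product. *)
Lemma kernel_value_P1 (m : seq (D1 * D1)) (k k' : D1)
    (G : {ffun D -> 'I_n} -> R^o) :
    pairs_up [set: D1]%SET (rcons m (k, k')) ->
    (forall i c, G (join_index i c) =
       (c 0 == i k)%:R * s (c 0) * ((c 1 == i k')%:R * s (c 1))
         * pairing_array s m i) ->
  exists2 Theta, lspan P_maps Theta & forall eta c,
    sym2_val (Theta eta) (basis_pair c) =
    2^-1 * (kernel_value G eta c + kernel_value G eta (swap_index c)).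
Proof.
move=> Am GE; have [tau tauE] := perm_of_pairs Am.
have := size_pairs_up Am; rewrite size_rcons => sm.
exists (P1 eps b hl (tau^-1)%g); first by apply: sub_lspan; left; exists (tau^-1)%g.
move=> eta c; rewrite P1_contraction contraction_perm.
have [tk tk'] : tau (pair_fst (last_pair hl)) = k /\ tau (pair_snd (last_pair hl)) = k'.
  by have [-> ->] := tauE x0 (last_pair hl); rewrite /= -sm /= nth_rcons ltnn eqxx.
pose rest i := \prod_(j < 2 * l | j != last_pair hl)
  invmx (gram eps b) (i (tau (pair_fst j))) (i (tau (pair_snd j))).
have wE i : weight i * pairing_array s m i = s (i k) * s (i k') * rest i.
  rewrite (weight_perm tau) (bigD1 (last_pair hl)) //= tk tk' -[LHS]mulrA; congr (_ * _).
  pose F j := pair_factor s (nth x0 (rcons m (k, k')) j).1 (nth x0 (rcons m (k, k')) j).2 i.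
  have -> : pairing_array s m i = \prod_(j < 2 * l | j != last_pair hl) F j.
    rewrite prod_but_last /pairing_array (big_nth x0) big_mkord -sm /=.
    by apply: eq_bigr => j _; rewrite /F nth_rcons ltn_ord.
  rewrite -big_split; apply: eq_bigr => j _ /=; rewrite /F.
  have [<- <-] := tauE x0 j.
  by rewrite weight_pair_factor invmx_gramE.
have E c' : kernel_value G eta c' =
    \sum_(i : index1) (c' 0 == i k)%:R * (c' 1 == i k')%:R * rest i * components eta i.
  apply: eq_bigr => i _; congr (_ * _); rewrite GE mulrCA wE.
  case: eqP => [->|_]; last by rewrite !mul0r.
  case: eqP => [->|_]; last by rewrite !(mul0r, mulr0).
  by rewrite !mul1r mulrA mulrACA !s2 !mul1r.
rewrite !E -big_split mulr_sumr; apply: eq_bigr => i _ /=.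
rewrite (bigD1 (last_pair hl)) //= tk tk' P1_coef_last !ffunE /= -!mulrA; congr (_ * _).
rewrite !mulrA -!mulrDl; congr (_ * _ * _); apply: eq_bigr => j /negPf jl.
by rewrite /P1_coef jl.
Qed.

Lemma slots_rcons (T : finType) (m : seq (T * T)) p :
  slots (rcons m p) = slots m ++ [:: p.1; p.2].
Proof. by rewrite /slots map_rcons flatten_rcons. Qed.

Lemma inl_inj : injective (inl : D1 -> D).
Proof. by move=> x y []. Qed.

(** The partners of the two slots of the value decide which of the two kinds of
    contraction arises. *)
Lemma pairing_value (m : seq (D * D)) : pairs_up [set: D]%SET m ->
  exists2 Theta, lspan P_maps Theta & forall eta c,
    sym2_val (Theta eta) (basis_pair c) =
    2^-1 * (kernel_value (pairing_array s m) eta c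
            + kernel_value (pairing_array s m) eta (swap_index c)).
Proof.
move=> Am.
have [y [m1 [yl _ Am1 mE]]] := extract_pair s Am (finset.in_setT (inr 0)).
case: y => [k|y] in yl Am1 mE.
  have [|y [m2 [y1 yA Am2 m1E]]] := extract_pair s (k := inr 1) Am1 _.
    by rewrite !inE.
  case: y => [k'|y] in y1 yA Am2 m1E; last first.
    by case: (ord2P y) => Ey; rewrite Ey ?eqxx // !inE ?eqxx ?andbF in y1 yA.
  have k'k : k' != k by move: yA; rewrite !inE => /andP[].
  have [|m' m2E] := pairs_inl (m := m2).
    move=> [j|j] jm; first by exists j.
    have [_ /(_ (inr j))] := Am2; rewrite jm !inE.
    by case: (ord2P j) => ->; rewrite ?eqxx ?andbF.
  apply: (@kernel_value_P1 m' k k').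
    split=> [|x].
      have [um2 _] := Am2; rewrite m2E slots_inl (map_inj_uniq inl_inj) in um2.
      rewrite slots_rcons /= cat_uniq um2 /= negb_or !andbT !inE eq_sym k'k andbT orbF.
      rewrite -!(mem_map inl_inj) -slots_inl -m2E; have [_ Am2E] := Am2.
      by rewrite -!Am2E !inE !eqxx /= ?andbF.
    rewrite slots_rcons mem_cat -(mem_map inl_inj) -slots_inl -m2E.
    have [_ <-] := Am2; rewrite !inE /= !(inj_eq inl_inj).
    by case: (x == k); case: (x == k').
  move=> i c; rewrite mE m1E m2E pairing_array_inl mulrA.
  by rewrite /pair_factor !ffunE.
have y1 : y = 1 by case: (ord2P y) => Ey //; rewrite Ey eqxx in yl.
rewrite {}y1 {yl} in Am1 mE.
have [|m' m1E] := pairs_inl (m := m1).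
  move=> [j|j] jm; first by exists j.
  have [_ /(_ (inr j))] := Am1; rewrite jm !inE.
  by case: (ord2P j) => ->; rewrite ?eqxx ?andbF.
apply: (@kernel_value_P2 m').
  split=> [|x].
    by have [um _] := Am1; rewrite m1E slots_inl (map_inj_uniq inl_inj) in um.
  by rewrite -(mem_map inl_inj) -slots_inl -m1E; have [_ <-] := Am1; rewrite !inE.
move=> i c; rewrite mE m1E pairing_array_inl.
by rewrite /pair_factor !ffunE.
Qed.

Lemma kernel_value_linear a G H eta c :
  kernel_value (a *: G + H) eta c = a * kernel_value G eta c + kernel_value H eta c.
Proof.
rewrite /kernel_value mulr_sumr -big_split; apply: eq_bigr => i _ /=.
rewrite -[(a *: G + H) _]/(a * G _ + H _) mulrDr mulrDl mulrCA.
by rewrite -!mulrA.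
Qed.

Lemma span_pairing_value G : lspan (pairing_arrays s [set: D]%SET) G ->
  exists2 Theta, lspan P_maps Theta & forall eta c,
    sym2_val (Theta eta) (basis_pair c) =
    2^-1 * (kernel_value G eta c + kernel_value G eta (swap_index c)).
Proof.
move: G; apply: lspan_ind.
- exists 0; first exact: lspan0.
  move=> eta c; rewrite /kernel_value !big1 ?addr0 ?mulr0 // => i _.
  by rewrite mulr0 mul0r.
- move=> a G H [T1 ST1 T1E] [T2 ST2 T2E]; exists (a *: T1 + T2); first exact: lspanP.
  move=> eta c; rewrite !kernel_value_linear.
  rewrite -[LHS]/(a * sym2_val (T1 eta) _ + sym2_val (T2 eta) _) T1E T2E.
  by ring.
- by move=> _ [m Am <-]; exact: pairing_value.
Qed.

End PairingValue.

(** * The kernel of an equivariant map *)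

Section Kernel.
Variables (R : realType) (V : vectType R) (eps : {symmetric V}).
Hypothesis eps_nondeg : nondegenerate eps.
Variables (l n : nat) (hl : (0 < l)%N) (b : n.-tuple V) (s : 'I_n -> R).
Hypothesis ob : orthonormal_basis eps b s.
Let s2 a : s a * s a = 1. Proof. by case: ob. Qed.
Let hb : basis_of {:V} b. Proof. by case: ob. Qed.

Local Notation D1 := 'I_(4 * l).
Local Notation D := (D1 + 'I_2)%type.
Local Notation index1 := {ffun D1 -> 'I_n}.
Local Notation index2 := {ffun 'I_2 -> 'I_n}.
Implicit Types (i : index1) (c : index2) (eta : curvature_tensor V l).

Lemma multilinear_basis_ext k (t u : cotensor V k) : multilinear t -> multilinear u ->
    (forall i : {ffun 'I_k -> 'I_n}, t (fun j => tnth b (i j)) = u (fun j => tnth b (i j))) ->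
  t = u.
Proof.
move=> mt mu tu; apply: funext => x.
have -> : x = (fun j => \sum_a coord b a (x j) *: tnth b a).
  by apply: funext => j; exact: coord_expand.
rewrite !(multilinear_expand (tnth b) (fun j a => coord b a (x j))) //.
by apply: eq_bigr => y _; rewrite tu.
Qed.

Lemma components_inj : injective (components (l := l) b).
Proof.
move=> u v uv; apply: val_inj.
apply: multilinear_basis_ext; [exact: multilinear_curvature.. |].
by move=> i; have /(congr1 (@^~ i)) := uv.
Qed.

Lemma multilinear_sym2 (f : sym2 V) : multilinear (sym2_val f).
Proof. by case: f => f /= /asboolP[]. Qed.

Lemma sym2_basis_ext (f g : sym2 V) :
  (forall c, sym2_val f (basis_pair b c) = sym2_val g (basis_pair b c)) -> f = g.
Proof.
move=> fg; apply: val_inj.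
by apply: multilinear_basis_ext; [exact: multilinear_sym2.. |].
Qed.

Lemma sym2_swap (f : sym2 V) c :
  sym2_val f (basis_pair b (swap_index c)) = sym2_val f (basis_pair b c).
Proof.
case: f => f /= /asboolP[_ sf].
have tE c' : basis_pair b c' = tnth [tuple tnth b (c' 0); tnth b (c' 1)].
  by apply: funext => k; rewrite (tnth_nth 0); case: (ord2P k) => ->.
by rewrite !tE sf !ffunE.
Qed.

Definition endo_fun (M : 'I_n -> 'I_n -> R) (v : V) : V :=
  \sum_a coord b a v *: \sum_x M a x *: tnth b x.

Lemma endo_fun_linear M : linear (endo_fun M).
Proof.
move=> k u v; rewrite scaler_sumr -big_split; apply: eq_bigr => x _ /=.
by rewrite linearP scalerDl scalerA.
Qed.

HB.instance Definition _ M := GRing.isLinear.Build R V V *:%R (endo_fun M)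
  (endo_fun_linear M).

Definition endo M : 'End(V) := linfun (endo_fun M).

Lemma endo_basis M a : endo M (tnth b a) = \sum_x M a x *: tnth b x.
Proof.
rewrite lfunE /= /endo_fun.
rewrite (bigD1 a) //= coord_tnth // eqxx scale1r [X in _ + X]big1 ?addr0 // => x xa.
by rewrite coord_tnth // eq_sym (negPf xa) scale0r.
Qed.

Lemma endo_orthogonal M : orthogonal_matrix s M -> orthogonal_group eps (endo M).
Proof.
move=> oM; have iso u v : eps (endo M u) (endo M v) = eps u v.
  have gE w : endo M w = \sum_a coord b a w *: endo M (tnth b a).
    rewrite {1}(coord_expand w hb) linear_sum; apply: eq_bigr => a _.
    by rewrite linearZ.
  rewrite (form_sum eps (gE u) (gE v)).
  rewrite (form_sum eps (coord_expand u hb) (coord_expand v hb)).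
  apply: eq_bigr => x _; apply: eq_bigr => y _; congr (_ * _).
  have [_ _ bE] := ob; rewrite bE -oM.
  rewrite (form_sum eps (endo_basis M x) (endo_basis M y)).
  apply: eq_bigr => c _; rewrite (bigD1 c) //= bE eqxx mul1r mulrAC [X in _ + X]big1 ?addr0 // => d dc.
  by rewrite bE eq_sym (negPf dc) mul0r mulr0.
split=> //; apply/lker0P => u v uv; apply/eqP; rewrite -subr_eq0; apply/eqP.
apply: (nondegenerate_eq0 eps_nondeg) => w.
by rewrite -iso linearB /= uv subrr linear0l.
Qed.

Lemma components_pullback M eta :
  components b (curvature_pullback (endo M) eta) = act M (components b eta).
Proof.
apply: funext => i; rewrite /components /= /pullback.
rewrite (_ : (fun j => _) = (fun j => \sum_x M (i j) x *: tnth b x)); last first.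
  by apply: funext => j; rewrite endo_basis.
rewrite (multilinear_expand (tnth b) (fun j => M (i j))) //.
exact: multilinear_curvature.
Qed.

Lemma sym2_pullback_endo M (f : sym2 V) c :
  sym2_val (sym2_pullback (endo M) f) (basis_pair b c) =
  \sum_(d : index2) (\prod_k M (c k) (d k)) * sym2_val f (basis_pair b d).
Proof.
rewrite sym2_pullbackE.
rewrite (_ : (fun j => _) = (fun j => \sum_x M (c j) x *: tnth b x)); last first.
  by apply: funext => j; rewrite endo_basis.
rewrite (multilinear_expand (tnth b) (fun j => M (c j))) //.
exact: multilinear_sym2.
Qed.

Lemma dot_act (M : 'I_n -> 'I_n -> R) (x y : index1 -> R^o) :
  dot x (act M y) = dot (act (fun a d => M d a) x) y.
Proof.
rewrite /dot /act; under eq_bigr => i _ do rewrite mulr_sumr.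
under [RHS]eq_bigr => i _ do rewrite mulr_suml.
rewrite exchange_big; apply: eq_bigr => i _; apply: eq_bigr => j _ /=.
by rewrite mulrCA mulrA.
Qed.

Lemma sum_join_index (f : {ffun D -> 'I_n} -> R) :
  \sum_z f z = \sum_(i : index1) \sum_(c : index2) f (join_index i c).
Proof.
rewrite pair_bigA (reindex (fun p : index1 * index2 => join_index p.1 p.2)) //=.
exists (fun z : {ffun D -> 'I_n} =>
  ([ffun k => z (inl k)] : index1, [ffun k => z (inr k)] : index2)) => [[i c] _|z _].
  by congr (_, _); apply/ffunP => k; rewrite !ffunE.
by apply/ffunP => x; rewrite ffunE; case: x => k; rewrite ffunE.
Qed.

Section EquivariantMap.
Variable phi : curvature_tensor V l -> sym2 V.
Hypothesis phi_eq : equivariant_maps eps l phi.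

Let W : set (index1 -> R^o) := [set w | exists eta, components b eta = w].

Lemma components_subspace : subspace W.
Proof.
split; first by exists 0.
by move=> a _ _ [u <-] [v <-]; exists (a *: u + v).
Qed.

Lemma equivariant_kernel : exists K : index2 -> index1 -> R^o,
  (forall c, W (K c)) /\
  forall eta c, sym2_val (phi eta) (basis_pair b c) = dot (K c) (components b eta).
Proof.
have [lphi _] := phi_eq.
suff : forall c, exists Kc, W Kc /\ forall eta,
    sym2_val (phi eta) (basis_pair b c) = dot Kc (components b eta).
  by move=> /choice[K KP]; exists K; split=> [c|eta c]; have [] := KP c.
move=> c.
(* the functional on [W] is defined through a section, arbitrary off [W] *)
have /choice[sec secP] : forall w, exists eta, W w -> components b eta = w.
  by move=> w; have [[eta <-]|nW] := pselect (W w); [exists eta | exists 0].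
have [|Kc WK KE] := riesz_representation
    (f := fun w => sym2_val (phi (sec w)) (basis_pair b c)) components_subspace.
  move=> a u v Wu Wv.
  have -> : sec (a *: u + v) = a *: sec u + sec v.
    apply: components_inj; rewrite secP; last by apply: (proj2 components_subspace).
    by rewrite -{1}(secP u) // -{1}(secP v).
  by rewrite lphi.
exists Kc; split => // eta; rewrite -KE; last by exists eta.
by rewrite (_ : sec _ = eta) //; apply: components_inj; rewrite secP //; exists eta.
Qed.

(** The kernel, with its argument indices lowered, is an orthogonally invariant
    array: equivariance determines [act M^T (K c)] by duality, because this
    array lies in [W] again. *)
Lemma equivariant_kernel_value : exists2 G : {ffun D -> 'I_n} -> R^o,
  lspan (pairing_arrays s [set: D]%SET) G &
  forall eta c, sym2_val (phi eta) (basis_pair b c) = kernel_value b s G eta c.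
Proof.
have [lphi ephi] := phi_eq; have [K [WK KE]] := equivariant_kernel.
pose restr1 (i : {ffun D -> 'I_n}) : index1 := [ffun k => i (inl k)].
pose restr2 (i : {ffun D -> 'I_n}) : index2 := [ffun k => i (inr k)].
pose G : {ffun D -> 'I_n} -> R^o := fun z => weight s (restr1 z) * K (restr2 z) (restr1 z).
have GE i c : G (join_index i c) = weight s i * K c i.
  by rewrite /G; congr (weight s _ * K _ _); apply/ffunP => k; rewrite !ffunE.
have weight2 i : weight s i * weight s i = 1.
  by rewrite -big_split big1 // => k _; exact: s2.
exists G; last first.
  move=> eta c; rewrite KE; apply: eq_bigr => i _.
  by rewrite GE mulrA weight2 mul1r.
apply: invariant_pairings => //; apply: invariant_on_of_group => // M oM.
have KM c : act (fun a d => M d a) (K c) = \sum_(d : index2) (\prod_k M (c k) (d k)) *: K d.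
  apply: (dot_inj components_subspace).
  - by have [eta <-] := WK c; rewrite -components_pullback; eexists.
  - have [W0 WD] := components_subspace.
    elim/big_ind: _ => // [u v Wu Wv|d _]; first by rewrite -[u]scale1r; apply: WD.
    by rewrite -[_ *: _]addr0; apply: WD.
  move=> _ [eta <-]; rewrite -dot_act -components_pullback -KE.
  rewrite ephi; last exact: endo_orthogonal.
  rewrite sym2_pullback_endo.
  under eq_bigr => d _ do rewrite KE.
  rewrite /dot; under eq_bigr => d _ do rewrite mulr_sumr.
  rewrite exchange_big; apply: eq_bigr => i _ /=.
  by rewrite fct_sumE mulr_suml; apply: eq_bigr => d _; rewrite mulrA.
apply: funext => z; pose i := restr1 z; pose c := restr2 z.
have -> : z = join_index i c.
  by apply/ffunP => x; rewrite ffunE; case: x => k; rewrite ffunE.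
rewrite /act sum_join_index GE.
have GEjd j d : (\prod_k M (join_index i c k) (join_index j d k)) * G (join_index j d) =
    (\prod_k M (i k) (j k)) * weight s j * ((\prod_k M (c k) (d k)) * K d j).
  rewrite big_sumType /= GE mulrACA; congr (_ * _ * (_ * _));
  by apply: eq_bigr => k _; rewrite !ffunE.
transitivity (\sum_(j : index1) \sum_(i' : index1)
    \prod_k (M (i k) (j k) * s (j k) * M (i' k) (j k)) * K c i').
  apply: eq_bigr => j _; under eq_bigr => d _ do rewrite GEjd.
  rewrite -mulr_sumr; have /(congr1 (@^~ j)) := KM c; rewrite fct_sumE => <-.
  by rewrite mulr_sumr; apply: eq_bigr => i' _; rewrite !big_split /= mulrA.
rewrite exchange_big /=; under eq_bigr => i' _ do rewrite -mulr_suml.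
have oMi i' : \sum_(j : index1) \prod_k (M (i k) (j k) * s (j k) * M (i' k) (j k)) =
    (i == i')%:R * weight s i.
  rewrite -(bigA_distr_bigA (fun k x => M (i k) x * s x * M (i' k) x)) /= -prod_diag.
  by apply: eq_bigr => k _; exact: oM.
under eq_bigr => i' _ do rewrite oMi.
rewrite (bigD1 i) //= eqxx mul1r [X in _ + X]big1 ?addr0 // => i' ii'.
by rewrite eq_sym (negPf ii') !mul0r.
Qed.

(** Values of [phi] are symmetric, so its kernel may be symmetrized. *)
Lemma equivariant_span : lspan (P_maps eps hl b) phi.
Proof.
have [G SG GE] := equivariant_kernel_value.
have [Theta STheta ThetaE] := span_pairing_value hl ob SG.
suff -> : phi = Theta by [].
apply: funext => eta; apply: sym2_basis_ext => c.
by rewrite ThetaE -!GE sym2_swap; field.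
Qed.

End EquivariantMap.
End Kernel.

Theorem theorem1p6 (R : realType) (V : vectType R) (eps : {symmetric V})
    (heps : nondegenerate eps) (n : nat) (e : n.-tuple V)
    (he : basis_of {:V} e) (l : nat) (hl : (0 < l)%N) :
  equivariant_maps eps l =
    lspan ([set P1 eps e hl sigma | sigma in [set: 'S_(4 * l)]]
           `|` [set P2 eps e sigma | sigma in [set: 'S_(4 * l)]]).
Proof.
have [b [s ob]] := exists_orthonormal_basis heps (esym (size_basis he)).
apply/seteqP; split=> phi; last exact: span_equivariant ob he phi.
move=> /(equivariant_span heps hl ob); congr (lspan _ phi).
rewrite /P_maps; congr (_ `|` _).
  apply: eq_imagel => sigma _; apply: funext => eta.
  by rewrite (P1_basis_independent hl ob he).
apply: eq_imagel => sigma _; apply: funext => eta.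
by rewrite (P2_basis_independent ob he).
Qed.
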